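(* Put $a=\sqrt q$ and use $\mu=\zeta=q^{s-1/2}$. For the quotient $\Gamma_0(T)\backslash\mathcal T$, $$F_{\Gamma_0(T)}(\mu)=\begin{pmatrix}-a\mu & q \\ q & -a\mu\end{pmatrix},\qquad \det F_{\Gamma_0(T)}(\mu)=q(\mu^2-q),$$ $$S_{\Gamma_0(T)}(\mu)=\frac1{\mu^2-q}\begin{pmatrix}q-1 & \dfrac{a(\mu^2-1)}{\mu} \\[4pt] \dfrac{a(\mu^2-1)}{\mu} & q-1\end{pmatrix},$$ $$\det S_{\Gamma_0(T)}(\mu)=\frac{1-q\mu^2}{\mu^2(\mu^2-q)} .$$ Since the cusp-width matrix $W$ is scalar, $S_{\Gamma_0(T)}(\mu)$ is simultaneously the Jacobi scattering matrix and the classical automorphic constant-term matrix, i.e. $\mathcal S_{\mathrm{aut}}(s)=S_{\Gamma_0(T)}(q^{s-1/2})$.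
   Context: Let $q$ be a prime power, $K_\infty=\mathbb F_q(\!(T^{-1})\!)$, $\mathcal O_\infty=\mathbb F_q[\![T^{-1}]\!]$, $\mathcal K_\infty=\mathrm{PGL}_2(\mathcal O_\infty)$, $\mathcal T$ the Bruhat–Tits tree of $\mathrm{PGL}_2(K_\infty)$ with vertex set $\mathrm{PGL}_2(K_\infty)/\mathcal K_\infty$, and $\Gamma_0(T)$ the image in $\mathrm{PGL}_2(K_\infty)$ of the matrices in $\mathrm{GL}_2(\mathbb F_q[T])$ with lower-left entry in $T\mathbb F_q[T]$. For a quotient vertex $v$ put $\lambda(v)=|\Gamma_0(T)_v|^{-1}$ (stabilizer of a lift). The adjacency operator is $(Af)(v)=\sum_e[\Gamma_v:\Gamma_e]f(t(e))$ with $\Gamma=\Gamma_0(T)$, the sum over $\Gamma_v$-orbits of oriented edges issuing from a lift of $v$, $\Gamma_e$ the stabilizer of $e$ in $\Gamma_v$, $t(e)$ the terminal quotient vertex. The quotient graph is a double ray with two cusps. Its two central vertices have lifts $v_0=\mathcal K_\infty$ and $v_1=\left(\begin{smallmatrix}0 & -1 \\ T & 0\end{smallmatrix}\right)\mathcal K_\infty$; they are taken as the finite core, and the free cusp channels start at the next vertices: $(c,n)$, $c\in\{\infty,0\}$ (the cusp $\infty$ attached to $v_0$, the cusp $0$ to $v_1$), $n\ge1$. Both directed indices across the central edge are $q$; the outward index from each central vertex is $1$ and the reverse index is $q$; $(Af)(c,n)=qf(c,n-1)+f(c,n+1)$ for $n\ge2$; and $\lambda(c,n)=w(q+1)q^{-n}$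 with $w=\frac1{q(q^2-1)}$ for both cusps, so $W=wI_2$. With $Uf=\lambda^{1/2}f$ and $a=\sqrt q$, $J=UAU^{-1}$ acts on $\mathbb C^2\oplus\ell^2(\mathbb N)^2$ as $J(u,g)=(H_Cu+Vg(1),h)$, $h(1)=ag(2)+V^*u$, $h(n)=a\{g(n-1)+g(n+1)\}$ ($n\ge2$), with $H_C=\left(\begin{smallmatrix}0 & q \\ q & 0\end{smallmatrix}\right)$, $V=\sqrt q\,I_2$. The matrices in the claim are $$F_{\Gamma_0(T)}(\zeta)=H_C-a(\zeta+\zeta^{-1})I_2+\frac{\zeta^{-1}}aVV^*,\qquad S_{\Gamma_0(T)}(\zeta)=-I_2+\frac{\zeta^{-1}-\zeta}aV^*F_{\Gamma_0(T)}(\zeta)^{-1}V .$$ The classical constant-term matrix $\mathcal S_{\mathrm{aut}}(s)$ is defined by: for $b\in\mathbb C^2$, the generalized eigenfunction of $A$ with eigenvalue $q^s+q^{1-s}$ and incoming cusp term $q^{ns}b_c$ has cusp expansion $q^{ns}b_c+q^{n(1-s)}(\mathcal S_{\mathrm{aut}}(s)b)_c$ (meromorphically continued). *)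

(* Defs.v *)
From HB Require Import structures.
From mathcomp Require Import all_boot all_order all_algebra.
From mathcomp Require Import finmap.
From mathcomp Require Import complex.
From mathcomp Require Import all_classical all_reals all_analysis.

Set Implicit Arguments.
Unset Strict Implicit.
Unset Printing Implicit Defensive.

Import Order.TTheory GRing.Theory Num.Theory.
Import sesquilinear.

Local Open Scope classical_set_scope.
Local Open Scope ring_scope.
Local Open Scope complex_scope.
Local Open Scope sesquilinear_scope.

(** * Formal power series k[[X]] over a field *)

Record fps (k : fieldType) := Fps { fcoef : nat -> k }.

HB.instance Definition _ (k : fieldType) := gen_eqMixin (fps k).
HB.instance Definition _ (k : fieldType) := gen_choiceMixin (fps k).

Section FormalPowerSeries.
Variable k : fieldType.
Implicit Types p q r : fps k.

Lemma fpsP p q : (forall n, fcoef p n = fcoef q n) -> p = q.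
Proof. by case: p q => [f] [g] /= fg; congr Fps; apply/funext. Qed.

Definition fps_zero : fps k := Fps (fun=> 0).
Definition fps_one : fps k := Fps (fun n => (n == 0)%:R).
Definition fps_opp p : fps k := Fps (fun n => - fcoef p n).
Definition fps_add p q : fps k := Fps (fun n => fcoef p n + fcoef q n).
Definition fps_mul p q : fps k :=
  Fps (fun n => \sum_(i < n.+1) fcoef p i * fcoef q (n - i)).

Lemma fps_addA : associative fps_add.
Proof. by move=> p q r; apply: fpsP => n /=; rewrite addrA. Qed.
Lemma fps_addC : commutative fps_add.
Proof. by move=> p q; apply: fpsP => n /=; rewrite addrC. Qed.
Lemma fps_add0 : left_id fps_zero fps_add.
Proof. by move=> p; apply: fpsP => n /=; rewrite add0r. Qed.
Lemma fps_addN : left_inverse fps_zero fps_opp fps_add.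
Proof. by move=> p; apply: fpsP => n /=; rewrite addNr. Qed.

HB.instance Definition _ := GRing.isZmodule.Build (fps k)
  fps_addA fps_addC fps_add0 fps_addN.

(* Truncation to a polynomial, used to transfer the ring laws of {poly k}. *)
Definition fps_trunc N p : {poly k} := \poly_(i < N) fcoef p i.

Lemma fps_mulE N p q n : (n < N)%N ->
  fcoef (fps_mul p q) n = (fps_trunc N p * fps_trunc N q)`_n.
Proof.
move=> nN; rewrite coefM /=; apply: eq_bigr => i _.
have iN : (i < N)%N by rewrite (leq_ltn_trans _ nN)// -ltnS.
by rewrite !coef_poly iN (leq_ltn_trans (leq_subr i n) nN).
Qed.

Lemma fps_mulC : commutative fps_mul.
Proof.
by move=> p q; apply: fpsP => n; rewrite !(fps_mulE _ _ (ltnSn n)) mulrC.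
Qed.

Lemma fps_mulA : associative fps_mul.
Proof.
move=> p q r; apply: fpsP => n; rewrite !(fps_mulE _ _ (ltnSn n)).
transitivity ((fps_trunc n.+1 p * (fps_trunc n.+1 q * fps_trunc n.+1 r))`_n).
  rewrite !coefM; apply: eq_bigr => i _; congr (_ * _).
  have nin : (n - i < n.+1)%N by rewrite ltnS leq_subr.
  by rewrite {1}/fps_trunc coef_poly nin (fps_mulE _ _ nin).
rewrite mulrA !coefM; apply: eq_bigr => i _; congr (_ * _).
by rewrite {3}/fps_trunc coef_poly ltn_ord (fps_mulE _ _ (ltn_ord i)).
Qed.

Lemma fps_mul1 : left_id fps_one fps_mul.
Proof.
move=> p; apply: fpsP => n /=; rewrite big_ord_recl /= mul1r subn0.
by rewrite big1 ?addr0// => i _; rewrite mul0r.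
Qed.

Lemma fps_mulDl : left_distributive fps_mul fps_add.
Proof.
move=> p q r; apply: fpsP => n /=; rewrite -big_split /=.
by apply: eq_bigr => i _; rewrite mulrDl.
Qed.

Lemma fps_one_neq0 : fps_one != 0.
Proof.
by apply/eqP => /(congr1 (fun p => fcoef p 0)) /= /eqP; rewrite oner_eq0.
Qed.

HB.instance Definition _ := GRing.Zmodule_isComNzRing.Build (fps k)
  fps_mulA fps_mulC fps_mul1 fps_mulDl fps_one_neq0.

Definition fps_unit : {pred fps k} := fun p => `[< exists q, q * p = 1 >].
Definition fps_inv p := if fps_unit p then xget p [set q | q * p = 1] else p.

Lemma fps_mulVx : {in fps_unit, left_inverse 1 fps_inv *%R}.
Proof.
move=> p pu; have fu : fps_unit p by [].
have /asboolP[q qp] := fu; rewrite /fps_inv fu.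
by case: xgetP => [y _ //|/(_ q)].
Qed.

Lemma fps_unitPl p q : q * p = 1 -> fps_unit p.
Proof. by move=> qp; apply/asboolP; exists q. Qed.

Lemma fps_invr_out : {in [predC fps_unit], fps_inv =1 id}.
Proof.
move=> p pu; have /negbTE fu : ~~ fps_unit p by [].
by rewrite /fps_inv fu.
Qed.

HB.instance Definition _ := GRing.ComNzRing_hasMulInverse.Build (fps k)
  fps_mulVx fps_unitPl fps_invr_out.

Lemma fps_lead p : p != 0 ->
  exists2 m, fcoef p m != 0 & forall i, (i < m)%N -> fcoef p i = 0.
Proof.
move=> p0; have ex : exists m, fcoef p m != 0.
  apply: contrapT => /forallNP h; move/eqP: p0; apply; apply: fpsP => n /=.
  by apply/eqP; move: (h n) => /negP; rewrite negbK.
case: (ex_minnP ex) => m pm min; exists m => // i im.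
by apply: contraTeq im => /min; rewrite -leqNgt.
Qed.

Lemma fps_integral p q : p * q = 0 -> (p == 0) || (q == 0).
Proof.
move=> pq; rewrite -[_ || _]negbK negb_or; apply/negP => /andP[].
move=> /fps_lead[m pm lm] /fps_lead[n qn ln].
move/(congr1 (fun p => fcoef p (m + n))): pq => /=.
have mmn : (m < (m + n).+1)%N by rewrite ltnS leq_addr.
rewrite (bigD1 (Ordinal mmn))//= addKn big1 ?addr0 => [/eqP|i].
  by rewrite mulf_eq0 (negbTE pm) (negbTE qn).
rewrite -val_eqE /= neq_ltn => /orP[im|mi]; first by rewrite lm// mul0r.
rewrite [X in _ * X]ln ?mulr0// ltn_subLR; last by rewrite -ltnS.
by rewrite ltn_add2r.
Qed.

HB.instance Definition _ := GRing.ComUnitRing_isIntegral.Build (fps k)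
  fps_integral.

End FormalPowerSeries.

Definition fpsX (k : fieldType) : fps k := Fps (fun n => (n == 1)%:R).

(** * The Bruhat-Tits tree of PGL_2(K_oo) and the group Gamma_0(T) *)

(* O_oo = k[[1/T]] is [fps k], its variable being 1/T, and K_oo = k((1/T)) is
   its field of fractions. *)
Notation Kinf k := {fraction (fps k)}.

Definition mx2 (A : Type) (a b c d : A) : 'M[A]_2 :=
  \matrix_(i < 2, j < 2)
    if i == 0 then (if j == 0 then a else b) else (if j == 0 then c else d).

Section Tree.
Variable k : fieldType.
Local Notation K := (Kinf k).
Local Notation M2 := 'M[K]_2.

Definition Tinf : K := ((@FracField.tofrac (fps k)) (fpsX k))^-1.

Definition constK (c : k) : K :=
  @FracField.tofrac (fps k) (Fps (fun n => if n == 0 then c else 0)).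

Definition polyK (p : {poly k}) : K := (map_poly constK p).[Tinf].

Definition setM (A B : set M2) : set M2 := [set a *m b | a in A & b in B].

(* The element of PGL_2(K_oo) represented by g is the class K_oo^* g.  A left
   coset of a subgroup of PGL_2(K_oo) is represented by its preimage in
   GL_2(K_oo), so that products of elements and the action of PGL_2(K_oo) on
   cosets are all given by the elementwise product [setM]. *)
Definition pgl (g : M2) : set M2 := [set z *: g | z in [set z : K | z != 0]].

Definition PGL2K : set (set M2) := [set pgl g | g in [set g | g \in unitmx]].

(* Preimage in GL_2(K_oo) of PGL_2(O_oo). *)
Definition calK : set M2 :=
  \bigcup_(h in [set h : 'M[fps k]_2 | h \in unitmx])
     pgl (map_mx (@FracField.tofrac (fps k)) h).

Definition vertex_of (g : M2) : set M2 := setM (pgl g) calK.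

Definition vertices : set (set M2) := [set setM P calK | P in PGL2K].

(* The edges are the translates of the standard edge joining the classes of the
   lattices O_oo^2 and diag(T, 1) O_oo^2. *)
Definition adjacent (v w : set M2) : Prop :=
  exists2 g : M2, g \in unitmx &
    v = vertex_of g /\ w = vertex_of (g *m mx2 Tinf 0 0 1).

Definition Gamma0T : set (set M2) :=
  [set pgl (map_mx polyK g) | g in
     [set g : 'M[{poly k}]_2 | (g \in unitmx) && ('X %| g 1 0)]].

Definition stab (v : set M2) : set (set M2) :=
  [set P | Gamma0T P /\ setM P v = v].

(* Since the tree has no multiple edges, an oriented edge issuing from v is
   represented by its terminal vertex. *)
Definition edges_from (v : set M2) : set (set M2) := [set w | adjacent v w].

Definition edge_orbits (v : set M2) : set (set (set M2)) :=
  [set [set setM P w | P in stab v] | w in edges_from v].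

(* Cardinality of a finite set (and 0 for an infinite one). *)
Definition ncard (A : choiceType) (X : set A) : nat := #|` fset_set X|%fset.

Definition coset_index (G H : set (set M2)) : nat :=
  ncard [set [set setM P Q | Q in H] | P in G].

Definition edge_index (v w : set M2) : nat :=
  coset_index (stab v) (stab v `&` stab w).

Definition Gamma_orbit (v : set M2) : set (set M2) :=
  [set setM P v | P in Gamma0T].

(* sigma_c carries the cusp oo to the cusp c; the index 0 stands for the cusp oo
   and the index 1 for the cusp 0. *)
Definition cusp_scaling (c : 'I_2) : M2 :=
  if c == 0 then 1%:M else mx2 0 (-1) Tinf 0.

(* [cusp_lift c 0] is the central vertex to which the cusp c is attached, and
   [cusp_lift c n], for n >= 1, is a lift of the vertex (c, n). *)
Definition cusp_lift (c : 'I_2) (n : nat) : set M2 :=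
  vertex_of (cusp_scaling c *m mx2 (Tinf ^+ n) 0 0 1).

End Tree.

Arguments cusp_lift k c n : clear implicits.

(** * Operators on the quotient graph *)

Section Operators.
Variables (R : realType) (k : finFieldType).
Local Notation C := R[i].
Local Notation M2 := 'M[Kinf k]_2.

Definition qR : R := #|k|%:R.
Definition qC : C := qR%:C.
Definition aC : C := (Num.sqrt qR)%:C.

(* Functions on the quotient graph are the Gamma_0(T)-invariant functions on the
   vertices of the tree; values outside [vertices k] are irrelevant. *)
Definition quotient_function (f : set M2 -> C) : Prop :=
  forall P v, Gamma0T P -> vertices v -> f (setM P v) = f v.

(* The summand depends on the choice of an edge in the orbit o only if f is not
   invariant. *)
Definition adjA (f : set M2 -> C) (v : set M2) : C :=
  \sum_(o \in edge_orbits v)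
     (let w := xget v o in (edge_index v w)%:R * f w).

Definition lam (v : set M2) : R := (ncard (stab v))%:R^-1.

Definition opU (f : set M2 -> C) (v : set M2) : C := (Num.sqrt (lam v))%:C * f v.
Definition opUinv (f : set M2 -> C) (v : set M2) : C :=
  ((Num.sqrt (lam v))%:C)^-1 * f v.

Definition jacobiJ (f : set M2 -> C) : set M2 -> C := opU (adjA (opUinv f)).

(* Indicator function of the quotient vertex below v. *)
Definition delta_at (v w : set M2) : C := (w \in Gamma_orbit v)%:R.

(* The blocks of J on the core and from the first channel sites to the core. *)
Definition HC : 'M[C]_2 :=
  \matrix_(i, j) jacobiJ (delta_at (cusp_lift k j 0)) (cusp_lift k i 0).
Definition VC : 'M[C]_2 :=
  \matrix_(i, c) jacobiJ (delta_at (cusp_lift k c 1)) (cusp_lift k i 0).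

Definition Fmat (zeta : C) : 'M[C]_2 :=
  HC - (aC * (zeta + zeta^-1))%:M + (zeta^-1 / aC) *: (VC *m VC ^t*).

Definition Smat (zeta : C) : 'M[C]_2 :=
  - 1%:M + ((zeta^-1 - zeta) / aC) *: (VC ^t* *m invmx (Fmat zeta) *m VC).

Definition cusp_width_matrix (W : 'M[C]_2) : Prop :=
  is_diag_mx W /\ forall c n, (0 < n)%N ->
    (lam (cusp_lift k c n))%:C = W c c * (qC + 1) / qC ^+ n.

(* f is a generalized eigenfunction of L for the eigenvalue E, with incoming
   cusp terms x^n b_c and outgoing cusp terms y^n b'_c. *)
Definition generalized_eigenfunction (L : (set M2 -> C) -> set M2 -> C)
    (E x y : C) (b b' : 'cV[C]_2) (f : set M2 -> C) : Prop :=
  [/\ quotient_function f,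
      forall v, vertices v -> L f v = E * f v &
      forall c n, (0 < n)%N ->
        f (cusp_lift k c n) = x ^+ n * b c 0 + y ^+ n * b' c 0].

(* For each b, the generalized eigenfunction with incoming data b exists, is
   unique, and has outgoing data S b. *)
Definition scattering_matrix (L : (set M2 -> C) -> set M2 -> C)
    (E x y : C) (S : 'M[C]_2) : Prop :=
  forall b : 'cV[C]_2,
    [/\ exists f, generalized_eigenfunction L E x y b (S *m b) f,
        forall b' f, generalized_eigenfunction L E x y b b' f -> b' = S *m b &
        forall b1 b2 f1 f2, generalized_eigenfunction L E x y b b1 f1 ->
          generalized_eigenfunction L E x y b b2 f2 ->
          forall v, vertices v -> f1 v = f2 v].

(* q^s = exp(s log q) *)
Definition qpow (s : C) : C :=
  (expR (complex.Re s * ln qR))%:C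
  * (cos (complex.Im s * ln qR) +i* sin (complex.Im s * ln qR)).

Definition constant_term_matrix (s : C) : 'M[C]_2 -> Prop :=
  scattering_matrix adjA (qpow s + qpow (1 - s)) (qpow s) (qpow (1 - s)).

Definition Saut (s : C) : 'M[C]_2 := xget 0 [set S | constant_term_matrix s S].

End Operators.

(* Main.v *)
From HB Require Import structures.
Require Import Defs.
From mathcomp Require Import all_boot all_order all_algebra.
From mathcomp Require Import finmap ring zify.
From mathcomp Require Import complex.
From mathcomp Require Import all_classical all_reals all_analysis.

Set Implicit Arguments.
Unset Strict Implicit.
Unset Printing Implicit Defensive.

Import Order.TTheory GRing.Theory Num.Theory.

Local Open Scope classical_set_scope.
Local Open Scope ring_scope.
Local Open Scope complex_scope.

(* Vertices of the tree are cosets in GL_2(K_oo), and by the Iwasawa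
   decomposition every vertex is represented by some [T^e x; 0 1].  Moving
   towards the end oo until x is absorbed reaches the standard apartment
   {diag(T^e, 1)}, and each neighbour of an apartment vertex is Gamma_0(T)-
   equivalent to an apartment vertex; so the apartment meets every orbit, and
   comparing degrees in D_m^-1 g D_n (where both diagonal entries of g are
   nonzero because T divides the lower-left one) shows that it meets each orbit
   once.  By orbit-stabilizer the adjacency operator is the plain sum over the
   q + 1 neighbours, whence the local equations (A f)(c, n) = q f(c, n - 1) +
   f(c, n + 1) with (c, -1) read as the other central vertex.  For
   f = x^n b + y^n b' with x y = q these reduce to a 2x2 linear system relating
   b and b', solved by the matrix of the statement; conjugation by lambda^(1/2)
   transports everything to J. *)

(** * Laurent series *)

Section LaurentSeries.
Variable k : fieldType.
Implicit Types (p q u : fps k) (x y : Kinf k) (c : k).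
Local Notation K := (Kinf k).
Local Notation T := (Tinf k).
Local Notation tofrac := (@FracField.tofrac (fps k)).

Lemma fcoefM0 p q : fcoef (p * q) 0 = fcoef p 0 * fcoef q 0.
Proof. by rewrite /= big_ord1. Qed.

Lemma fcoefXM p n : fcoef (fpsX k * p) n.+1 = fcoef p n.
Proof.
rewrite /= 2!big_ord_recl big1 => [|i _] /=; last by rewrite mul0r.
by rewrite mul0r add0r addr0 mul1r subSS subn0.
Qed.

Lemma fcoefX0 p : fcoef (fpsX k * p) 0 = 0.
Proof. by rewrite fcoefM0 mul0r. Qed.

Lemma fpsX_dvd p : fcoef p 0 = 0 -> exists q, p = fpsX k * q.
Proof.
move=> p0; exists (Fps (fun n => fcoef p n.+1)).
by apply: fpsP => -[|n]; rewrite ?fcoefX0// fcoefXM.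
Qed.

Lemma fcoef_sum (I : Type) (r : seq I) (F : I -> fps k) n :
  fcoef (\sum_(i <- r) F i) n = \sum_(i <- r) fcoef (F i) n.
Proof. by elim/big_rec2: _ => // i a b _ <-. Qed.

Lemma fcoef_expX q n i : (i < n)%N -> fcoef ((fpsX k * q) ^+ n) i = 0.
Proof.
elim: n i => // n IH [|i] ni; rewrite exprS -mulrA ?fcoefX0// fcoefXM /=.
rewrite big1// => j _; rewrite IH ?mulr0//.
by rewrite (leq_ltn_trans (leq_subr _ _)).
Qed.

(* The inverse of [1 - X r] is the geometric series in [X r], which converges
   coefficientwise. *)
Lemma fps_unitP u : (u \is a GRing.unit) = (fcoef u 0 != 0).
Proof.
apply/idP/idP => [/mulrV/(congr1 (fun p => fcoef p 0))|u0].
  rewrite fcoefM0 /= => h; apply/eqP => u0.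
  by move/eqP: h; rewrite u0 mul0r eq_sym oner_eq0.
pose c : fps k := Fps (fun n => if n == 0%N then (fcoef u 0)^-1 else 0).
have /fpsX_dvd[r Er] : fcoef (1 - c * u) 0 = 0.
  by rewrite /= big_ord1 /= mulVf// subrr.
have cu : c * u = 1 - fpsX k * r by rewrite -Er opprB addrC subrK.
pose S n := \sum_(i < n) (fpsX k * r) ^+ i.
pose v : fps k := Fps (fun n => fcoef (S n.+1) n).
suff vE : v * (c * u) = 1.
  by apply/unitrPr; exists (v * c); rewrite mulrC -mulrA.
have vS n i : (i < n)%N -> fcoef v i = fcoef (S n) i.
  move=> ni; rewrite /v /= /S !fcoef_sum.
  rewrite (big_ord_widen _ (fun j => fcoef ((fpsX k * r) ^+ j) i) ni).
  rewrite [RHS](bigID (fun j : 'I_n => (j < i.+1)%N)) /= [X in _ = _ + X]big1 ?addr0//.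
  by move=> j; rewrite -leqNgt => ij; rewrite fcoef_expX.
apply: fpsP => n; rewrite cu.
(* Only coefficients of index at most n enter, so [v] may be replaced by a partial sum, for which
   the product telescopes to 1 - (X r)^(n+1). *)
transitivity (fcoef (S n.+1 * (1 - fpsX k * r)) n).
  by rewrite /=; apply: eq_bigr => i _; congr (_ * _); exact: vS.
rewrite mulrC -opprB mulNr -subrX1 opprB /= fcoef_expX ?subr0//.
Qed.

Lemma T_neq0 : T != 0.
Proof.
rewrite invr_eq0 tofrac_eq0; apply/eqP => /(congr1 (fun p => fcoef p 1)) /=.
by move/eqP; rewrite oner_eq0.
Qed.

Lemma Kinf_mulf_neq0 x y : x != 0 -> y != 0 -> x * y != 0.
Proof. exact: mulf_neq0. Qed.

Lemma tofracX : tofrac (fpsX k) = T^-1.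
Proof. by rewrite invrK. Qed.

Lemma tofrac_inj : injective tofrac.
Proof. by move=> p q /eqP; rewrite tofrac_eq => /eqP. Qed.

Lemma tofracV u : fcoef u 0 != 0 -> tofrac u^-1 = (tofrac u)^-1.
Proof.
by rewrite -fps_unitP => uu; rewrite rmorphV.
Qed.

Lemma unit_neq0 u : fcoef u 0 != 0 -> tofrac u != 0.
Proof. by move=> u0; rewrite tofrac_eq0; apply: contraNneq u0 => ->. Qed.

Lemma fps_factor p : p != 0 ->
  exists n u, fcoef u 0 != 0 /\ tofrac p = T ^- n * tofrac u.
Proof.
move=> /fps_lead[n]; elim: n p => [|n IH] p pn lo.
  by exists 0%N, p; rewrite expr0 invr1 mul1r.
have [q pE] := fpsX_dvd (lo 0%N isT).
have [||m [u [u0 qE]]] := IH q; first by rewrite -fcoefXM -pE.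
  by move=> i im; rewrite -fcoefXM -pE lo.
exists m.+1, u; split=> //.
by rewrite pE rmorphM /= qE tofracX exprS invfM mulrA.
Qed.

Lemma K_frac x : exists p q, q != 0 /\ x = tofrac p / tofrac q.
Proof.
set r := repr x; have r0 : r.2 != 0 := denom_ratioP r.
exists r.1, r.2; split=> //.
apply: (canRL (mulfK _)); first by rewrite tofrac_eq0.
rewrite -[x in LHS]reprK -/r; unlock FracField.tofrac; rewrite -[LHS]FracField.pi_mul.
apply/eqmodP; rewrite /= FracField.equivfE /FracField.mulf.
by rewrite !numden_Ratio ?mulf_neq0 ?oner_eq0// !mulr1 mulrC.
Qed.

(** K_oo is discretely valued with uniformizer 1/T: e is minus the valuation of x, and u is a unit
    of O_oo. *)
Lemma K_factor x : x != 0 ->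
  exists (e : int) u, fcoef u 0 != 0 /\ x = T ^ e * tofrac u.
Proof.
have [p [q [q0 ->]]] := K_frac x.
rewrite mulf_eq0 negb_or tofrac_eq0 => /andP[/fps_factor[n [u [u0 ->]]] _].
have [m [v [v0 ->]]] := fps_factor q0.
exists (m%:Z - n%:Z), (u * v^-1); split.
  by rewrite -fps_unitP unitrM unitrV !fps_unitP u0.
rewrite rmorphM /= tofracV// invfM invrK expfzDr ?T_neq0// -invr_expz.
by rewrite -!exprnP; ring.
Qed.

(** The ball T^e O_oo. Bounding degrees through it needs no convention for the degree of 0. *)
Definition degle (e : int) x := exists p : fps k, x = T ^ e * tofrac p.

Lemma degle0 e : degle e 0.
Proof. by exists 0; rewrite rmorph0 mulr0. Qed.

Lemma degle0P x : degle 0 x <-> exists p, x = tofrac p.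
Proof. by split=> -[p ->]; exists p; rewrite expr0z mul1r. Qed.

Lemma degle_shift e f x : degle (e + f) (T ^ f * x)%R <-> degle e x.
Proof.
split=> -[p xE]; exists p.
  by move: xE; rewrite addrC expfzDr ?T_neq0// -mulrA; apply/mulfI/expfz_neq0/T_neq0.
by rewrite xE addrC expfzDr ?T_neq0// mulrA.
Qed.

Lemma degle_mono e f x : e <= f -> degle e x -> degle f x.
Proof.
move=> ef [p ->]; have [n ->] : exists n : nat, f = e + n%:Z.
  by exists `|f - e|%N; rewrite gez0_abs ?subr_ge0//; ring.
exists (fpsX k ^+ n * p).
rewrite rmorphM rmorphXn /= tofracX expfzDr ?T_neq0// exprVn -exprnP -!mulrA.
by rewrite mulVKf// expf_neq0// T_neq0.
Qed.

(** If f exceeded e, cancelling T^e would make u divisible by X, against its nonzero constant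
    term. *)
Lemma degle_unit e f u : fcoef u 0 != 0 -> degle e (T ^ f * tofrac u)%R -> f <= e.
Proof.
move=> u0 [p]; rewrite leNgt => h; apply/negP => ef; move: h.
have [n ->] : exists n : nat, f = e + n.+1%:Z.
  by exists `|f - e|.-1; rewrite prednK ?absz_gt0 ?subr_eq0 ?gt_eqF// gez0_abs ?subr_ge0 ?ltW//; ring.
rewrite expfzDr ?T_neq0// -mulrA => /mulfI-/(_ (expfz_neq0 _ T_neq0)).
move/(congr1 (fun x => T ^- n.+1 * x)); rewrite mulrA -exprnP mulVf ?expf_neq0 ?T_neq0// mul1r.
rewrite -exprVn -tofracX -rmorphXn -rmorphM => /tofrac_inj uE.
by move: u0; rewrite uE exprS -mulrA fcoefX0 eqxx.
Qed.

Lemma T_unit_inj e f u v : fcoef u 0 != 0 -> fcoef v 0 != 0 ->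
  T ^ e * tofrac u = T ^ f * tofrac v -> e = f.
Proof.
move=> u0 v0 E; apply/le_anti/andP; split.
  by apply: (degle_unit u0); rewrite E; exists v.
by apply: (degle_unit v0); rewrite -E; exists u.
Qed.

(** * Constants and polynomials inside K_oo *)

Fact constK_is_zmod_morphism : zmod_morphism (@constK k).
Proof.
move=> a b; rewrite /constK -rmorphB; congr tofrac.
by apply: fpsP => -[|n] //=; rewrite subr0.
Qed.

Fact constK_is_monoid_morphism : monoid_morphism (@constK k).
Proof.
split=> [|a b].
  by rewrite /constK -[RHS](rmorph1 tofrac); congr tofrac; apply: fpsP => -[].
rewrite /constK -rmorphM; congr tofrac; apply: fpsP => -[|n] /=.
  by rewrite big_ord1.
by rewrite big1// => -[[|i] ?] _; rewrite ?mul0r// subn0 mulr0.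
Qed.

HB.instance Definition _ := GRing.isZmodMorphism.Build k K (@constK k)
  constK_is_zmod_morphism.
HB.instance Definition _ := GRing.isMonoidMorphism.Build k K (@constK k)
  constK_is_monoid_morphism.

Fact polyK_is_zmod_morphism : zmod_morphism (@polyK k).
Proof.
by move=> P Q; rewrite /polyK (rmorphB (map_poly (@constK k))) hornerD hornerN.
Qed.

Fact polyK_is_monoid_morphism : monoid_morphism (@polyK k).
Proof.
split=> [|P Q]; rewrite /polyK ?(rmorph1 (map_poly (@constK k))) ?hornerC//.
by rewrite (rmorphM (map_poly (@constK k))) hornerM.
Qed.

HB.instance Definition _ := GRing.isZmodMorphism.Build {poly k} K (@polyK k)
  polyK_is_zmod_morphism.
HB.instance Definition _ := GRing.isMonoidMorphism.Build {poly k} K (@polyK k)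
  polyK_is_monoid_morphism.

Lemma polyKC c : polyK c%:P = constK (c : k).
Proof. by rewrite /polyK (map_polyC (@constK k)) hornerC. Qed.

Lemma polyKX : polyK 'X = T.
Proof. by rewrite /polyK (map_polyX (@constK k)) hornerX. Qed.

Lemma polyK0 : polyK (0 : {poly k}) = 0. Proof. exact: rmorph0. Qed.
Lemma polyK1 : polyK (1 : {poly k}) = 1. Proof. exact: rmorph1. Qed.
Lemma polyKN : {morph (@polyK k) : P / - P}. Proof. exact: rmorphN. Qed.
Lemma polyKD : {morph (@polyK k) : P Q / P + Q}. Proof. exact: rmorphD. Qed.
Lemma polyKM : {morph (@polyK k) : P Q / P * Q}. Proof. exact: rmorphM. Qed.
Definition polyKE := (polyK0, polyK1, polyKX, polyKC, polyKN, polyKD, polyKM).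

(* The reversal of the coefficient sequence is the power series of
   [T ^- d * P] where [d = deg P]. *)
Lemma polyK_lead (P : {poly k}) : P != 0 ->
  exists u, fcoef u 0 != 0 /\ polyK P = T ^ (size P).-1%:Z * tofrac u.
Proof.
move=> P0.
pose r n := Fps (fun i => if (i < n)%N then P`_(n.-1 - i) else 0).
suff rE n : (0 < n)%N ->
    \sum_(i < n) constK P`_i * T ^+ i = T ^ n.-1%:Z * tofrac (r n).
  exists (r (size P)); split.
    by rewrite /= size_poly_gt0 P0 subn0 -lead_coefE lead_coef_eq0.
  rewrite -rE ?size_poly_gt0// /polyK horner_coef size_map_poly.
  by apply: eq_bigr => i _; rewrite coef_map.
case: n => // n _; elim: n => [|n IH] /=.
  rewrite big_ord1 expr0 mulr1 expr0z mul1r; congr tofrac.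
  by apply: fpsP => -[].
rewrite big_ord_recr /= {}IH /=.
(* Reversal puts the new top coefficient first and shifts the older ones by one power of X. *)
have -> : r n.+2 = Fps (fun i => if i == 0%N then P`_n.+1 else 0) + fpsX k * r n.+1.
  apply: fpsP => -[|i].
    by rewrite [RHS]/= big_ord1 mul0r addr0 /= subn0.
  transitivity (0 + fcoef (fpsX k * r n.+1) i.+1); last by [].
  by rewrite fcoefXM add0r.
rewrite tofracD tofracM tofracX mulrDr addrC /constK -!exprnP; congr (_ + _).
  by rewrite mulrC.
by rewrite exprSr -!mulrA mulVKf ?T_neq0.
Qed.

(** Turns valuation bounds into bounds on polynomial size. The case P = 0 stands apart because its
    [(size P).-1] is 0, whereas e may be negative. *)
Lemma degle_polyK e (P : {poly k}) :
  degle e (polyK P) <-> P = 0 \/ ((size P).-1%:Z <= e).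
Proof.
split=> [|[->|]]; last 2 first.
- by rewrite rmorph0; apply: degle0.
- have [->|P0] := eqVneq P 0; first by rewrite rmorph0 => _; apply: degle0.
  have [u [_ ->]] := polyK_lead P0; move=> h; apply: degle_mono h _; by exists u.
have [|P0] := eqVneq P 0; first by left.
by have [u [u0 ->]] := polyK_lead P0 => /(degle_unit u0); right.
Qed.

Lemma polyK_inj : injective (@polyK k).
Proof.
move=> P Q /eqP; rewrite -subr_eq0 -rmorphB => /eqP E.
apply/eqP; rewrite -subr_eq0; apply/negPn/negP => /polyK_lead[u [u0]].
rewrite E => /esym/eqP; rewrite mulf_eq0 (negbTE (unit_neq0 u0)) orbF.
by rewrite (negbTE (expfz_neq0 _ T_neq0)).
Qed.

End LaurentSeries.

(** * Two-by-two matrices *)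

Section Mx2.

Lemma mx2E (A : Type) (a b c d : A) :
  ((mx2 a b c d 0 0 = a) * (mx2 a b c d 0 1 = b) *
   (mx2 a b c d 1 0 = c) * (mx2 a b c d 1 1 = d))%type.
Proof. by rewrite !mxE. Qed.

Lemma ord2P (i : 'I_2) : i = 0 \/ i = 1.
Proof. by case: i => -[|[|//]] i2; [left|right]; apply: val_inj. Qed.

Lemma mx2P (A : Type) (m n : 'M[A]_2) :
  [/\ m 0 0 = n 0 0, m 0 1 = n 0 1, m 1 0 = n 1 0 & m 1 1 = n 1 1] -> m = n.
Proof. by case=> *; apply/matrixP => i j; case: (ord2P i) (ord2P j) => -> [] ->. Qed.

Lemma mx2_eta (A : Type) (m : 'M[A]_2) : m = mx2 (m 0 0) (m 0 1) (m 1 0) (m 1 1).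
Proof. by apply: mx2P; rewrite !mx2E. Qed.

Lemma mx2_inj (A : Type) (a b c d a' b' c' d' : A) :
  mx2 a b c d = mx2 a' b' c' d' -> [/\ a = a', b = b', c = c' & d = d'].
Proof.
by move=> /matrixP E; move: (E 0 0) (E 0 1) (E 1 0) (E 1 1); rewrite !mx2E.
Qed.

Lemma mx2_map (A B : Type) (f : A -> B) (a b c d : A) :
  map_mx f (mx2 a b c d) = mx2 (f a) (f b) (f c) (f d).
Proof. by apply: mx2P; split; rewrite [LHS]mxE !mx2E. Qed.

Variable A : comNzRingType.
Implicit Types (a b c d : A) (m : 'M[A]_2).

Lemma mx2M a b c d a' b' c' d' :
  mx2 a b c d *m mx2 a' b' c' d' =
  mx2 (a * a' + b * c') (a * b' + b * d') (c * a' + d * c') (c * b' + d * d').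
Proof.
by apply: mx2P; split; rewrite mxE !big_ord_recl big_ord0 addr0 ?lift0;
  rewrite (_ : lift ord0 ord0 = 1) ?mx2E//; apply/val_inj.
Qed.

Lemma mx2Z z a b c d : z *: mx2 a b c d = mx2 (z * a) (z * b) (z * c) (z * d).
Proof. by apply: mx2P; split; rewrite [LHS]mxE !mx2E. Qed.

Lemma mx2D a b c d a' b' c' d' :
  mx2 a b c d + mx2 a' b' c' d' = mx2 (a + a') (b + b') (c + c') (d + d').
Proof. by apply: mx2P; split; rewrite [LHS]mxE !mx2E. Qed.

Lemma mx2N a b c d : - mx2 a b c d = mx2 (- a) (- b) (- c) (- d).
Proof. by apply: mx2P; split; rewrite [LHS]mxE !mx2E. Qed.

Lemma mx2_scalar a : a%:M = mx2 a 0 0 a.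
Proof. by apply: mx2P; split; rewrite [LHS]mxE !mx2E. Qed.

Lemma mx2_det a b c d : \det (mx2 a b c d) = a * d - b * c.
Proof.
rewrite (expand_det_row _ 0) !big_ord_recl big_ord0 addr0.
rewrite /cofactor !det_mx11 !mxE /=.
by ring.
Qed.

Lemma mx2_detE m : \det m = m 0 0 * m 1 1 - m 0 1 * m 1 0.
Proof. by rewrite {1}[m]mx2_eta mx2_det. Qed.

Definition adj2 m : 'M[A]_2 := mx2 (m 1 1) (- m 0 1) (- m 1 0) (m 0 0).

Lemma mul_mx_adj2 m : m *m adj2 m = (\det m)%:M.
Proof.
rewrite mx2_detE {1}[m]mx2_eta mx2M mx2_scalar.
by congr mx2; ring.
Qed.

End Mx2.

(** * Vertices as cosets *)

Section Cosets.
Variable k : fieldType.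
Local Notation tofrac := (@FracField.tofrac (fps k)).
Local Notation K := (Kinf k).
Local Notation T := (Tinf k).
Local Notation M2 := 'M[K]_2.
Implicit Types (m p g : M2) (P Q v w : set M2).

Lemma setMA P Q v : setM (setM P Q) v = setM P (setM Q v).
Proof.
apply/seteqP; split=> x.
  move=> [_ [a Pa [b Qb <-]]] [c vc <-]; exists a => //; exists (b *m c).
    by exists b => //; exists c.
  by rewrite mulmxA.
move=> [a Pa [_ [b Qb [c vc <-]] <-]]; exists (a *m b).
  by exists a => //; exists b.
by exists c => //; rewrite mulmxA.
Qed.

Lemma pgl_scale z g : z != 0 -> pgl g (z *: g).
Proof. by move=> z0; exists z. Qed.

Lemma pgl_id g : pgl g g.
Proof. by rewrite -[X in pgl _ X]scale1r; apply/pgl_scale/oner_neq0. Qed.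

Lemma pglM g h : setM (pgl g) (pgl h) = pgl (g *m h).
Proof.
apply/seteqP; split=> x.
  move=> [_ [z z0 <-]] [_ [y y0 <-] <-].
  by rewrite -scalemxAl -scalemxAr scalerA; apply/pgl_scale/Kinf_mulf_neq0.
move=> [z z0 <-]; exists (z *: g); first exact: pgl_scale.
by exists h; [exact: pgl_id|rewrite -scalemxAl].
Qed.

Lemma pglZ z g : z != 0 -> pgl (z *: g) = pgl g.
Proof.
move=> z0; apply/seteqP; split=> _ [y y0 <-].
  by rewrite scalerA; apply/pgl_scale/Kinf_mulf_neq0.
rewrite -[y](divfK z0) -scalerA; apply/pgl_scale/(Kinf_mulf_neq0 y0).
by rewrite invr_eq0.
Qed.

(** The scalar is normalised to a power of T; its unit part is absorbed into h. *)
Lemma calKP m : calK m <->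
  exists e h, h \in unitmx /\ m = T ^ e *: map_mx tofrac h.
Proof.
split=> [[h hu [z z0 <-]]|[e [h [hu ->]]]]; last first.
  by exists h => //; exists (T ^ e)%R => //; apply/expfz_neq0/T_neq0.
have [e [u [u0 ->]]] := K_factor z0; exists e, (u *: h); split.
  rewrite unitmxE detZ unitrM -unitmxE hu andbT.
  by apply: unitrX; rewrite fps_unitP.
by rewrite -scalerA; congr (_ *: _); apply/matrixP => i j; rewrite !mxE rmorphM.
Qed.

Lemma calK_tofrac (h : 'M[fps k]_2) : fcoef (\det h) 0 != 0 ->
  calK (map_mx tofrac h).
Proof.
by move=> h0; apply/calKP; exists 0, h; rewrite expr0z scale1r unitmxE fps_unitP.
Qed.

Lemma calKZ z m : z != 0 -> calK m -> calK (z *: m).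
Proof.
move=> z0 [h hu [y y0 <-]]; exists h => //.
by rewrite scalerA; apply/pgl_scale/Kinf_mulf_neq0.
Qed.

Lemma calK1 : calK (1%:M : M2).
Proof.
rewrite -(map_mx1 tofrac); apply: calK_tofrac.
by rewrite det1 oner_eq0.
Qed.

Lemma calKM m n : calK m -> calK n -> calK (m *m n).
Proof.
move=> [h hu [z z0 <-]] [i iu [y y0 <-]]; exists (h *m i).
  by rewrite /= unitmx_mul hu.
rewrite -scalemxAl -scalemxAr scalerA -map_mxM.
by apply/pgl_scale/Kinf_mulf_neq0.
Qed.

Lemma calKV m : calK m -> exists2 n, calK n & m *m n = 1%:M.
Proof.
move=> [h hu [z z0 <-]]; exists (z^-1 *: map_mx tofrac (invmx h)).
  by exists (invmx h); [rewrite /= unitmx_inv|apply: pgl_scale; rewrite invr_eq0].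
by rewrite -scalemxAl -scalemxAr scalerA divff// scale1r -map_mxM mulmxV// map_mx1.
Qed.

Lemma calK_unit m : calK m -> m \in unitmx.
Proof. by move=> /calKV[n _ mn]; exact: (mulmx1_unit mn).1. Qed.

(** An element of T^e GL_2(O_oo) has determinant of degree 2e, so the determinant alone determines
    e, and e bounds all entries. *)
Lemma calK_det m d u : calK m -> fcoef u 0 != 0 ->
    \det m = T ^ d * tofrac u ->
  exists e, d = e + e /\ forall i j, degle e (m i j).
Proof.
move=> /calKP[e [h [hu ->]]] u0; rewrite detZ det_map_mx expr2 -expfzDr ?T_neq0//.
move=> /esym E; exists e; split.
  apply: T_unit_inj E => //; by move: hu; rewrite unitmxE fps_unitP.
by move=> i j; exists (h i j); rewrite !mxE.
Qed.

Lemma vertex_ofE g : vertex_of g = [set g *m n | n in @calK k].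
Proof.
apply/seteqP; split=> x.
  move=> [_ [z z0 <-] [n nK <-]]; exists (z *: n); first exact: calKZ.
  by rewrite -scalemxAl -scalemxAr.
by move=> [n nK <-]; exists g; [exact: pgl_id|exists n].
Qed.

Lemma vertex_of_id g : vertex_of g g.
Proof. by rewrite vertex_ofE; exists 1%:M; [exact: calK1|rewrite mulmx1]. Qed.

Lemma vertex_of_calK g n : calK n -> vertex_of (g *m n) = vertex_of g.
Proof.
move=> nK; rewrite !vertex_ofE; apply/seteqP; split=> _ [x xK <-].
  by exists (n *m x); rewrite ?mulmxA//; apply: calKM.
have [n' n'K nn'] := calKV nK; exists (n' *m x); first exact: calKM.
by rewrite -mulmxA (mulmxA n) nn' mul1mx.
Qed.

Lemma vertex_ofZ z g : z != 0 -> vertex_of (z *: g) = vertex_of g.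
Proof. by move=> z0; rewrite /vertex_of pglZ. Qed.

Lemma vertex_of_eq g h : vertex_of g = vertex_of h ->
  exists2 n, calK n & h = g *m n.
Proof.
by move=> E; have := vertex_of_id h; rewrite -E vertex_ofE => -[n nK <-]; exists n.
Qed.

Lemma vertex_of_pgl g h : setM (pgl g) (vertex_of h) = vertex_of (g *m h).
Proof. by rewrite /vertex_of -setMA pglM. Qed.

Lemma verticesP v : vertices v <-> exists2 g, g \in unitmx & v = vertex_of g.
Proof.
split=> [[_ [g gu <-] <-]|[g gu ->]]; first by exists g.
by exists (pgl g) => //; exists g.
Qed.

End Cosets.

(** * The group [Gamma0T] *)

Section GammaGroup.
Variable k : fieldType.
Local Notation K := (Kinf k).
Local Notation T := (Tinf k).
Local Notation M2 := 'M[K]_2.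
Implicit Types (P Q v w : set M2) (g h : 'M[{poly k}]_2).

Definition Gamma0T_mx : set 'M[{poly k}]_2 :=
  [set g | (g \in unitmx) && ('X %| g 1 0)].

(** The units of k[T] are the nonzero constants, so invertibility becomes a polynomial identity on
    which [ring] can work. *)
Lemma Gamma0T_mxP a b c d : Gamma0T_mx (mx2 a b ('X * c) d) <->
  exists2 e : k, e != 0 & a * d - 'X * b * c = e%:P.
Proof.
rewrite /Gamma0T_mx /= mx2E dvdp_mulr ?dvdpp// andbT unitmxE mx2_det.
rewrite (_ : b * _ = 'X * b * c); last by rewrite mulrCA mulrA.
rewrite poly_unitE; split=> [/andP[/eqP s u]|[e e0 ->]].
  move: (eq_leq s) => /size1_polyC E; exists (a * d - 'X * b * c)`_0 => //.
  by rewrite unitfE in u.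
by rewrite size_polyC e0 coefC eqxx unitfE.
Qed.

Lemma Gamma0T_mx_eta g : Gamma0T_mx g ->
  exists a b c d, g = mx2 a b ('X * c) d /\
    exists2 e : k, e != 0 & a * d - 'X * b * c = e%:P.
Proof.
move=> Gg; have /andP[_ /dvdpP[c gc]] := Gg.
have gE : g = mx2 (g 0 0) (g 0 1) ('X * c) (g 1 1).
  by rewrite {1}[g]mx2_eta gc mulrC.
exists (g 0 0), (g 0 1), c, (g 1 1); split=> //.
by apply/Gamma0T_mxP; rewrite -gE.
Qed.

Definition gclass g : set M2 := pgl (map_mx (@polyK k) g).

Lemma Gamma0TP P : Gamma0T P <-> exists2 g, Gamma0T_mx g & P = gclass g.
Proof. by split=> [[g Gg <-]|[g Gg ->]]; exists g. Qed.

Lemma Gamma0T_unit g : Gamma0T_mx g -> map_mx (@polyK k) g \in unitmx.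
Proof.
case/andP; rewrite !unitmxE det_map_mx => gu _.
exact: (rmorph_unit (@polyK k) gu).
Qed.

Lemma Gamma0T_1 : Gamma0T (pgl (1%:M : M2)).
Proof.
exists 1%:M; last by rewrite map_mx1.
by rewrite /= unitmx1 !mxE dvdp0.
Qed.

Lemma Gamma0T_M P Q : Gamma0T P -> Gamma0T Q -> Gamma0T (setM P Q).
Proof.
move=> /Gamma0TP[g /Gamma0T_mx_eta[a [b [c [d [-> [e e0 ge]]]]]] ->].
move=> /Gamma0TP[h /Gamma0T_mx_eta[a' [b' [c' [d' [-> [e' e0' he]]]]]] ->].
rewrite /gclass pglM -map_mxM mx2M; apply/Gamma0TP.
exists (mx2 (a * a' + b * ('X * c')) (a * b' + b * d')
            ('X * (c * a' + d * c')) ('X * c * b' + d * d')).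
  apply/Gamma0T_mxP; exists (e * e'); first exact: mulf_neq0.
  by rewrite rmorphM /= -ge -he; ring.
by congr gclass; congr mx2; ring.
Qed.

Lemma Gamma0T_V P : Gamma0T P ->
  exists2 Q, Gamma0T Q & setM P Q = pgl 1%:M /\ setM Q P = pgl 1%:M.
Proof.
move=> /Gamma0TP[g /Gamma0T_mx_eta[a [b [c [d [-> [e e0 ge]]]]]] ->].
exists (gclass (mx2 d (- b) ('X * - c) a)).
  apply/Gamma0TP; eexists; last by [].
  by apply/Gamma0T_mxP; exists e => //; rewrite -ge; ring.
(* The adjugate is an inverse up to the scalar e, which is trivial in PGL_2. *)
have E : pgl (map_mx (@polyK k) e%:P%:M) = pgl (1%:M : M2).
  rewrite map_scalar_mx /= polyKC -[_%:M]scalemx1 pglZ//.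
  by rewrite fmorph_eq0.
rewrite /gclass !pglM -!map_mxM !mx2M -!E mx2_scalar.
by split; congr pgl; congr map_mx; congr mx2; rewrite -?ge; ring.
Qed.

Lemma Gamma0T_pgl P : Gamma0T P -> exists2 p, p \in unitmx & P = pgl p.
Proof.
move=> /Gamma0TP[g Gg ->]; exists (map_mx (@polyK k) g) => //.
exact: Gamma0T_unit.
Qed.

(** This is [cusp_scaling k 1]. As an involution of PGL_2 normalising Gamma_0(T), it transfers
    results from the cusp oo to the cusp 0. *)
Definition atkin_lehner : M2 := mx2 0 (-1) T 0.

Lemma atkin_lehner2 : setM (pgl atkin_lehner) (pgl atkin_lehner) = pgl 1%:M.
Proof.
rewrite pglM mx2M -[RHS](@pglZ _ (- T)) ?oppr_eq0 ?T_neq0//.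
by rewrite mx2_scalar mx2Z; congr pgl; congr mx2; ring.
Qed.

Lemma atkin_lehner_Gamma0T P : Gamma0T P ->
  Gamma0T (setM (setM (pgl atkin_lehner) P) (pgl atkin_lehner)).
Proof.
move=> /Gamma0TP[g /Gamma0T_mx_eta[a [b [c [d [-> [e e0 ge]]]]]] ->].
apply/Gamma0TP; exists (mx2 d (- c) ('X * - b) a).
  by apply/Gamma0T_mxP; exists e => //; rewrite -ge; ring.
rewrite /gclass !pglM !mx2_map !mx2M -[RHS](@pglZ _ (- T)) ?oppr_eq0 ?T_neq0//.
rewrite mx2Z !polyKE.
by congr pgl; congr mx2; ring.
Qed.

End GammaGroup.

(** * Neighbours *)

Section Neighbours.
Variable k : fieldType.
Local Notation K := (Kinf k).
Local Notation T := (Tinf k).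
Local Notation M2 := 'M[K]_2.
Local Notation tofrac := (@FracField.tofrac (fps k)).
Implicit Types (g : M2) (P Q v w : set M2).

(* The neighbours of the standard vertex are indexed by the projective line
   over k, with [None] as point at infinity. *)
Definition nb (i : option k) : M2 :=
  if i is Some c then mx2 T 0 (constK c * T) 1 else mx2 0 1 T 0.

Lemma det_nb i : \det (nb i) = if i is Some _ then T else - T.
Proof. by case: i => [c|]; rewrite mx2_det; ring. Qed.

Lemma nb_unit i : nb i \in unitmx.
Proof. by rewrite unitmxE det_nb unitfE; case: i; rewrite ?oppr_eq0 T_neq0. Qed.

Definition constF (c : k) : fps k := Fps (fun n => if n == 0%N then c else 0).

Lemma TX : T * tofrac (fpsX k) = 1.
Proof. by rewrite tofracX mulfV ?T_neq0. Qed.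

Lemma TXM (x : fps k) : T * tofrac (fpsX k * x) = tofrac x.
Proof. by rewrite tofracM mulrA TX mul1r. Qed.

(** The neighbour depends only on the constant terms of the first column (a, c), a point of the
    projective line: [None] if that of a vanishes, the ratio c/a otherwise. Row reduction by this
    point leaves a factor in GL_2(O_oo). *)
Lemma std_edge_nb (h : 'M[fps k]_2) : h \in unitmx ->
  exists i, exists2 n, calK n & map_mx tofrac h *m mx2 T 0 0 1 = nb i *m n.
Proof.
rewrite unitmxE fps_unitP {2}[h]mx2_eta.
move: (h 0 0) (h 0 1) (h 1 0) (h 1 1) (mx2_detE h) => a b c d -> h0.
rewrite mx2_map mx2M.
have [a0|a0] := eqVneq (fcoef a 0) 0.
  have [r rE] := fpsX_dvd a0; exists None.
  exists (map_mx tofrac (mx2 c (fpsX k * d) r b)).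
    apply: calK_tofrac; rewrite mx2_det.
    rewrite (_ : _ - _ = - (a * d - b * c)) /= ?oppr_eq0//.
    by rewrite rE; ring.
  rewrite mx2_map mx2M; congr mx2; last by rewrite TXM; ring.
  - by rewrite rE -(TXM r); ring.
  - by ring.
  - by ring.
pose c0 := fcoef c 0 / fcoef a 0.
have [r rE] : exists r, c - constF c0 * a = fpsX k * r.
  apply: fpsX_dvd; rewrite (_ : fcoef _ _ = fcoef c 0 - fcoef (constF c0 * a) 0)//.
  by rewrite fcoefM0 /= divfK ?subrr.
have cE : c = constF c0 * a + fpsX k * r by rewrite -rE; ring.
exists (Some c0).
exists (map_mx tofrac (mx2 a (fpsX k * b) r (d - constF c0 * b))).
  apply: calK_tofrac; rewrite mx2_det.
  by rewrite (_ : _ - _ = a * d - b * c)// cE; ring.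
have constE : constK c0 = tofrac (constF c0) by [].
rewrite mx2_map /nb mx2M; congr mx2.
- by ring.
- by rewrite TXM; ring.
- by rewrite cE constE tofracD tofracM -(TXM r); ring.
- by rewrite -mulrA TXM constE tofracB tofracM; ring.
Qed.

Lemma nb_std_edge i : exists2 n, calK n & n *m mx2 T 0 0 1 = nb i.
Proof.
case: i => [c|].
  exists (map_mx tofrac (mx2 1 0 (constF c) 1)).
    by apply: calK_tofrac; rewrite mx2_det mul1r mul0r subr0 oner_eq0.
  rewrite mx2_map /nb mx2M (_ : constK c = tofrac (constF c))// tofrac0 tofrac1.
  by congr mx2; ring.
exists (map_mx tofrac (mx2 0 1 1 0)).
  by apply: calK_tofrac; rewrite mx2_det mul1r mul0r sub0r /= oppr_eq0 oner_eq0.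
by rewrite mx2_map mx2M tofrac0 tofrac1; congr mx2; ring.
Qed.

Lemma adjacentP g w : g \in unitmx ->
  Defs.adjacent (vertex_of g) w <-> exists i, w = vertex_of (g *m nb i).
Proof.
move=> gu; split.
  move=> [g' _ [/vertex_of_eq[n nK ->] ->]].
  have [h hu [z z0 <-]] := nK.
  have [i [m mK E]] := std_edge_nb hu; exists i.
  rewrite -scalemxAr -scalemxAl vertex_ofZ// -mulmxA E mulmxA.
  exact: vertex_of_calK.
move=> [i ->]; have [n nK <-] := nb_std_edge i.
exists (g *m n); first by rewrite unitmx_mul gu; exact: calK_unit.
by split; [rewrite vertex_of_calK|rewrite -mulmxA].
Qed.

Lemma degle_T0 : ~ degle 0 T.
Proof.
rewrite -polyKX => /degle_polyK[/eqP|]; first by rewrite polyX_eq0.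
by rewrite size_polyX.
Qed.

(** The matrix n carrying one neighbour to the other has determinant 1 or -1, hence entries in O_oo.
    Distinct indices would force T, or a nonzero multiple (j - i) T, into O_oo. *)
Lemma nb_inj g i j : g \in unitmx ->
  vertex_of (g *m nb i) = vertex_of (g *m nb j) -> i = j.
Proof.
move=> gu /vertex_of_eq[n nK]; rewrite -mulmxA => /(can_inj (mulKmx gu)) E.
have n0 : forall a b, degle 0 (n a b).
  pose u : fps k := if (i == None) == (j == None) then 1 else - 1.
  have u0 : fcoef u 0 != 0.
    by rewrite /u; case: ifP => _ /=; rewrite ?oppr_eq0 oner_eq0.
  have [|e [/eqP]] := @calK_det _ n 0 u nK u0.
    rewrite expr0z mul1r; apply: (@mulfI _ (\det (nb i))).
      by have := nb_unit i; rewrite unitmxE unitfE.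
    rewrite -det_mulmx -E !det_nb /u.
    by case: (i) (j) => [?|] [?|]; rewrite /= ?tofracN tofrac1; ring.
  by rewrite eq_sym -mulr2n -mulr_natl mulf_eq0 /= => /eqP ->.
move: E; rewrite [n]mx2_eta; move: (n0 0 0) (n0 0 1) (n0 1 0) (n0 1 1).
move: (n 0 0) (n 0 1) (n 1 0) (n 1 1) => {n nK n0} a b c d a0 b0 c0 d0.
have T0 := @T_neq0 k.
case: i j => [i|] [j|] //; rewrite /nb mx2M => E;
  have {E}[E00 E01 E10 E11] := mx2_inj E.
- have a1 : a = 1 by apply: (mulfI T0); rewrite mulr1 [RHS]E00; ring.
  have : degle 0 (polyK ((j - i)%:P * 'X)).
    rewrite polyKM polyKC polyKX rmorphB mulrBl E10 a1.
    by rewrite (_ : _ - _ = c)//; ring.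
  move=> /degle_polyK[/eqP|].
    by rewrite mulf_eq0 polyX_eq0 orbF polyC_eq0 subr_eq0 => /eqP ->.
  have [->|ji] := eqVneq j i; first by [].
  by rewrite size_mulX ?polyC_eq0 ?subr_eq0// size_polyC subr_eq0 ji.
- have a_0 : a = 0 by apply: (mulfI T0); rewrite mulr0 [RHS]E00; ring.
  have Tc : T = c by rewrite [LHS]E10 a_0; ring.
  by case: degle_T0; rewrite Tc.
- have Tc : T = c by rewrite [LHS]E00; ring.
  by case: degle_T0; rewrite Tc.
Qed.

End Neighbours.

(** * The adjacency operator as a sum over neighbours *)

(** Infinite sets are included: both sides then take the default value 0. *)
Lemma ncard_eq (A B : choiceType) (X : set A) (Y : set B) :
  (X #= Y)%card -> ncard X = ncard Y.
Proof.
move=> XY; have := eq_finite_set XY; rewrite /ncard.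
have [fX|nX] := pselect (finite_set X) => fXY.
  have [n Xn] := fX; rewrite (card_fset_set Xn) (card_fset_set (n := n))//.
  by rewrite -(card_eql XY).
rewrite /fset_set; case: pselect => // _; case: pselect => // fY.
by case: nX; rewrite fXY.
Qed.

(** Two maps with the same fibres have images in bijection, through a chosen preimage [r]. *)
Lemma ncard_image_eq (A : pointedType) (B C : choiceType) (G : set A)
    (F : A -> B) (F' : A -> C) :
    (forall x y, G x -> G y -> F x = F y <-> F' x = F' y) ->
  ncard (F @` G) = ncard (F' @` G).
Proof.
move=> FF'; pose r b := xget point [set x | G x /\ F x = b].
have rP x : G x -> G (r (F x)) /\ F (r (F x)) = F x.
  by move=> Gx; apply: (@xgetI _ point [set y | G y /\ F y = F x] x).
have -> : F' @` G = (F' \o r) @` (F @` G).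
  apply/seteqP; split=> [_ [x Gx <-]|_ [_ [x Gx <-] <-]].
    exists (F x); first by exists x.
    by have [Gr Fr] := rP _ Gx; apply: (FF' _ _ Gr Gx).1.
  by exists (r (F x)) => //; have [] := rP _ Gx.
apply/esym/ncard_eq/inj_card_eq => _ _ /set_mem[x Gx <-] /set_mem[y Gy <-] /=.
have [Gx' Ex] := rP _ Gx; have [Gy' Ey] := rP _ Gy.
by move=> /(FF' _ _ Gx' Gy').2; rewrite Ex Ey.
Qed.

Lemma ncard_inj (A : pointedType) (B : choiceType) (X : set A) (F : A -> B) :
  {in X &, injective F} -> ncard (F @` X) = ncard X.
Proof. by move=> Fi; apply/ncard_eq/inj_card_eq. Qed.

Lemma ncard_fin (I : finType) (B : choiceType) (F : I -> B) (D : pred I) :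
  injective F -> ncard (F @` [set i | D i]) = #|D|.
Proof.
move=> Fi; have -> : F @` [set i | D i] = [set` [fset F i | i in D]%fset].
  apply/seteqP; split=> [_ [i Di <-]|x /imfsetP[i /= Di ->]]; last by exists i.
  by apply/imfsetP; exists i.
by rewrite /ncard set_fsetK card_imfset//= -cardE.
Qed.

Lemma vertices_of (k : fieldType) (g : 'M[Kinf k]_2) :
  g \in unitmx -> vertices (vertex_of g).
Proof. by move=> gu; apply/verticesP; exists g. Qed.

Lemma unitmxM2 (k : fieldType) (g h : 'M[Kinf k]_2) :
  g \in unitmx -> h \in unitmx -> g *m h \in unitmx.
Proof. by move=> gu hu; rewrite unitmx_mul gu. Qed.

(** * Stabilizers and their orbits *)

Section Stabilizers.
Variable k : fieldType.
Local Notation K := (Kinf k).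
Local Notation M2 := 'M[K]_2.
Implicit Types (g : M2) (P Q v w : set M2).

Lemma pgl1_vertex v : vertices v -> setM (pgl 1%:M) v = v.
Proof. by move=> /verticesP[g _ ->]; rewrite vertex_of_pgl mul1mx. Qed.

Lemma pgl1_Gamma0T P : Gamma0T P -> setM (pgl 1%:M) P = P.
Proof. by move=> /Gamma0T_pgl[p _ ->]; rewrite pglM mul1mx. Qed.

Lemma Gamma0T_pgl1 P : Gamma0T P -> setM P (pgl 1%:M) = P.
Proof. by move=> /Gamma0T_pgl[p _ ->]; rewrite pglM mulmx1. Qed.

Lemma stab1 v : vertices v -> stab v (pgl 1%:M).
Proof. by move=> vv; split; [exact: Gamma0T_1|exact: pgl1_vertex]. Qed.

Lemma stabM v P Q : stab v P -> stab v Q -> stab v (setM P Q).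
Proof.
by move=> [GP Pv] [GQ Qv]; split; [exact: Gamma0T_M|rewrite setMA Qv].
Qed.

Lemma stabV v P : vertices v -> stab v P ->
  exists2 Q, stab v Q & setM P Q = pgl 1%:M /\ setM Q P = pgl 1%:M.
Proof.
move=> vv [GP Pv]; have [Q GQ [PQ QP]] := Gamma0T_V GP; exists Q => //.
by split=> //; rewrite -{1}Pv -setMA QP pgl1_vertex.
Qed.

Definition stab_orbit v w := [set setM P w | P in stab v].

(** Orbit-stabilizer: the coset map and the orbit map on [stab v] have the same fibres. *)
Lemma edge_indexE v w : vertices v -> vertices w ->
  edge_index v w = ncard (stab_orbit v w).
Proof.
move=> vv vw; apply: (@ncard_image_eq (set M2)) => P P' Pv P'v.
have [Q Qv [PQ QP]] := stabV vv Pv; have [Q' Q'v [PQ' QP']] := stabV vv P'v.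
split=> E; last first.
  have H : (stab v `&` stab w) (setM Q P').
    split; first exact: stabM.
    split; first exact: (stabM Qv P'v).1.
    by rewrite setMA -E -setMA QP pgl1_vertex.
  have H' : (stab v `&` stab w) (setM Q' P).
    split; first exact: stabM.
    split; first exact: (stabM Q'v Pv).1.
    by rewrite setMA E -setMA QP' pgl1_vertex.
  apply/seteqP; split=> _ [R HR <-].
    exists (setM (setM Q' P) R).
      by split; [exact: stabM H'.1 HR.1|exact: stabM H'.2 HR.2].
    by rewrite -!setMA PQ' pgl1_Gamma0T//; case: Pv.
  exists (setM (setM Q P') R).
    by split; [exact: stabM H.1 HR.1|exact: stabM H.2 HR.2].
  by rewrite -!setMA PQ pgl1_Gamma0T//; case: P'v.
have : [set setM P' Q0 | Q0 in stab v `&` stab w] P.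
  rewrite -E; exists (pgl 1%:M); last by apply: Gamma0T_pgl1; case: Pv.
  by split; exact: stab1.
by move=> [R [_ [_ Rw]] <-]; rewrite setMA Rw.
Qed.

Lemma stab_orbit_id v w : vertices v -> vertices w -> stab_orbit v w w.
Proof. by move=> vv vw; exists (pgl 1%:M); [exact: stab1|exact: pgl1_vertex]. Qed.

Lemma stab_orbit_eq v w w' : vertices v -> vertices w ->
  stab_orbit v w w' -> stab_orbit v w' = stab_orbit v w.
Proof.
move=> vv vw [P Pv <-]; have [Q Qv [_ QP]] := stabV vv Pv.
apply/seteqP; split=> _ [R Rv <-].
  by rewrite -setMA; exists (setM R P) => //; exact: stabM.
exists (setM R Q); first exact: stabM.
by rewrite setMA -(setMA Q) QP pgl1_vertex.
Qed.

Lemma adjacent_Gamma0T P v w : Gamma0T P -> Defs.adjacent v w ->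
  Defs.adjacent (setM P v) (setM P w).
Proof.
move=> /Gamma0T_pgl[p pu ->] [g gu [-> ->]]; exists (p *m g).
  exact: unitmxM2 pu gu.
by rewrite !vertex_of_pgl mulmxA.
Qed.

End Stabilizers.

(** * The adjacency operator on invariant functions *)

Section AdjacencySum.
Variables (R : realType) (k : finFieldType).
Local Notation C := R[i].
Local Notation M2 := 'M[Kinf k]_2.
Implicit Types (f : set M2 -> C) (g : M2).

(** The edge index is the size of an orbit of neighbours and f is constant on that orbit, so each
    orbit contributes the sum of f over its members. *)
Lemma adjA_sum f g : quotient_function f -> g \in unitmx ->
  adjA f (vertex_of g) = \sum_(i : option k) f (vertex_of (g *m nb i)).
Proof.
move=> qf gu; set v := vertex_of g; pose w i := vertex_of (g *m nb i).
have vv : vertices v by exact: vertices_of.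
have vw i : vertices (w i) by exact: vertices_of (unitmxM2 gu (nb_unit i)).
pose orb i := stab_orbit v (w i).
pose r := undup [seq orb i | i : option k].
have rE : edge_orbits v = [set` r].
  apply/seteqP; split=> [_ [x /adjacentP-/(_ gu)[i ->] <-]|o]; rewrite /= mem_undup.
    by apply/mapP; exists i; rewrite // mem_enum.
  by move=> /mapP[i _ ->]; exists (w i) => //; apply/adjacentP => //; exists i.
rewrite /adjA rE -fsbig_seq ?undup_uniq//.
(* Double counting of pairs (neighbour, its orbit): summing over orbits outermost gives [adjA],
   while each neighbour lies in exactly one orbit. *)
transitivity (\sum_(i : option k) \sum_(o <- r | o == orb i) f (w i)).
  rewrite (exchange_big_dep xpredT)//= big_seq [RHS]big_seq.
  apply: eq_bigr => o; rewrite mem_undup => /mapP[i _ oE].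
  (* The orbit is nonempty, so [xget] never returns its default [v]. *)
  have [P Pv xE] : stab_orbit v (w i) (xget v o) by rewrite oE; exact: xgetI (stab_orbit_id vv (vw i)).
  have [j jE] : exists j, xget v o = w j.
    apply/(adjacentP _ gu); rewrite -xE -[X in Defs.adjacent X _]Pv.2.
    by apply: adjacent_Gamma0T; [exact: Pv.1|apply/adjacentP => //; exists i].
  have oj : o = orb j.
    by rewrite oE /orb -jE; apply/esym/stab_orbit_eq => //; exists P.
  rewrite jE edge_indexE// -/(orb j) -oj.
  have -> : ncard o = #|[pred i0 | o == orb i0]|.
    rewrite -(@ncard_fin _ _ w); last by move=> a b; exact: nb_inj.
    congr ncard; apply/seteqP; split=> [x|_ [l /= /eqP -> <-]]; last first.
      exact: stab_orbit_id.
    rewrite oE => -[Q Qv xE'].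
    have [l lE] : exists l, x = w l.
      apply/(adjacentP _ gu); rewrite -xE' -[X in Defs.adjacent X _]Qv.2.
      by apply: adjacent_Gamma0T; [exact: Qv.1|apply/adjacentP => //; exists i].
    exists l => //=; apply/eqP; rewrite /orb -lE; apply/esym/stab_orbit_eq => //.
    by exists Q.
  rewrite (eq_bigr (fun=> f (w j))) ?sumr_const ?mulr_natl// => l /eqP ol.
  have : orb j (w l) by rewrite -oj ol; exact: stab_orbit_id.
  by move=> [Q [GQ _] <-]; rewrite qf.
apply: eq_bigr => i _; rewrite -big_filter filter_pred1_uniq ?undup_uniq ?big_seq1//.
by rewrite mem_undup; apply/mapP; exists i; rewrite // mem_enum.
Qed.

Lemma adjA_Gamma0T f P v : quotient_function f -> Gamma0T P -> vertices v ->
  adjA f (setM P v) = adjA f v.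
Proof.
move=> qf GP /verticesP[g gu ->]; have [p pu PE] := Gamma0T_pgl GP.
rewrite PE vertex_of_pgl (adjA_sum qf (unitmxM2 pu gu)) (adjA_sum qf gu).
apply: eq_bigr => i _; rewrite -mulmxA -vertex_of_pgl -PE qf//.
exact: vertices_of (unitmxM2 gu (nb_unit i)).
Qed.

End AdjacencySum.

(** * The quotient graph *)

Section MatrixIdentities.
Variable F : fieldType.

(** For t = T and a constant x, the last factor lies in GL_2(O_oo), so a unipotent translation
    carries diag(y, T) to the neighbour [Some x] of diag(y, 1). *)
Lemma shear_identity (t y x : F) : t != 0 -> x != 0 ->
  mx2 y 0 0 1 *m mx2 t 0 (x * t) 1 =
  mx2 1 (x^-1 * y) 0 1 *m (mx2 y 0 0 t *m mx2 0 (- x^-1) x t^-1).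
Proof.
by move=> t0 x0; rewrite !mx2M; congr mx2; field; rewrite ?t0 ?x0.
Qed.

(** The Iwasawa step: once c / d is integral, the lower triangular factor lies in GL_2(O_oo). *)
Lemma clear_corner (a b c d : F) : d != 0 ->
  mx2 a b c d = d *: (mx2 ((a * d - b * c) / d ^+ 2) (b / d) 0 1 *m mx2 1 0 (c / d) 1).
Proof.
by move=> d0; rewrite mx2M mx2Z; congr mx2; field.
Qed.

End MatrixIdentities.

Section Quotient.
Variable k : fieldType.
Local Notation K := (Kinf k).
Local Notation T := (Tinf k).
Local Notation M2 := 'M[K]_2.
Local Notation tofrac := (@FracField.tofrac (fps k)).
Local Notation cl := (cusp_lift k).
Implicit Types (g : M2) (P Q v w : set M2) (c : 'I_2) (n : nat).

Definition dilation (e : int) : M2 := mx2 (T ^ e)%R 0 0 1.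

Lemma mx2_unit (a b c d : K) : a * d - b * c != 0 -> mx2 a b c d \in unitmx.
Proof. by rewrite unitmxE mx2_det unitfE. Qed.

Lemma dilation_unit e : dilation e \in unitmx.
Proof. by apply: mx2_unit; rewrite mulr1 mulr0 subr0 expfz_neq0 ?T_neq0. Qed.

Lemma cusp_scaling_unit c : cusp_scaling k c \in unitmx.
Proof.
rewrite /cusp_scaling; case: ifP => _; first exact: unitmx1.
by apply: mx2_unit; rewrite mulr0 mulN1r opprK add0r T_neq0.
Qed.

Lemma swap_calK : calK (mx2 0 1 1 0 : M2).
Proof.
have <- : map_mx tofrac (mx2 0 1 1 0) = mx2 0 1 1 0 :> M2.
  by rewrite mx2_map tofrac0 tofrac1.
by apply: calK_tofrac; rewrite mx2_det mul1r mul0r sub0r /= oppr_eq0 oner_eq0.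
Qed.

Lemma rot_calK : calK (mx2 0 (-1) 1 0 : M2).
Proof.
have <- : map_mx tofrac (mx2 0 (-1) 1 0) = mx2 0 (-1) 1 0 :> M2.
  by rewrite mx2_map tofracN tofrac0 tofrac1.
by apply: calK_tofrac; rewrite mx2_det mulr1 mul0r sub0r opprK /= oner_eq0.
Qed.

Definition cusp_mx c n : M2 := cusp_scaling k c *m mx2 (T ^+ n)%R 0 0 1.

Lemma cusp_liftE c n : cl c n = vertex_of (cusp_mx c n).
Proof. by []. Qed.

Lemma cusp_mx_unit c n : cusp_mx c n \in unitmx.
Proof. exact: unitmxM2 (cusp_scaling_unit c) (dilation_unit n). Qed.

Lemma vertices_cusp c n : vertices (cl c n).
Proof. exact: vertices_of (cusp_mx_unit c n). Qed.

(* The vertices diag(T^e, 1) with e >= 0 run into the cusp oo, those with e < 0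
   into the cusp 0; [Negz n] is -(n + 1). *)
Definition cusp_exponent c n : int := if c == 0 then Posz n else Negz n.

Lemma cusp_lift_dilation c n : cl c n = vertex_of (dilation (cusp_exponent c n)).
Proof.
rewrite cusp_liftE /cusp_mx /cusp_exponent; have [->|->] := ord2P c.
  by rewrite /= mul1mx.
have -> : cusp_scaling k 1 = mx2 0 (-1) T 0 by [].
have -> : (if (1 : 'I_2) == 0 then Posz n else Negz n) = Negz n by [].
(* Up to the scalar T^(n+1) and a rotation of the columns, the lift at the cusp 0 is diag(T^-(n+1),
   1); the shift by one comes from the entry T of the scaling matrix. *)
rewrite -(vertex_of_calK (dilation _) rot_calK).
rewrite -[RHS](@vertex_ofZ _ (T ^+ n.+1)) ?expf_neq0 ?T_neq0//.
rewrite /dilation !mx2M mx2Z NegzE -invr_expz -exprnP -exprS.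
rewrite !(mul0r, mulr0, add0r, addr0, mul1r, mulr1, mulrN1) mulrN mulfV//.
exact/expf_neq0/T_neq0.
Qed.

Lemma dilation_cusp_lift e : exists c n, vertex_of (dilation e) = cl c n.
Proof.
case: e => n; [exists 0, n|exists 1, n]; by rewrite cusp_lift_dilation.
Qed.

Lemma cusp_exponent_inj c n c' n' :
  cusp_exponent c n = cusp_exponent c' n' -> c = c' /\ n = n'.
Proof.
rewrite /cusp_exponent.
by have [->|->] := ord2P c; have [->|->] := ord2P c' => //= -[->].
Qed.

(** The matrix h = D_m^-1 g D_n lies in [calK] with determinant of degree n - m = 2r, so its entries
    have degree at most r. This gives deg a <= -r and deg d <= r; as a and d are nonzero, r = 0. *)
Lemma Gamma0T_dilation (a b c d : {poly k}) (m n : int) :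
    Gamma0T_mx (mx2 a b ('X * c) d) ->
    setM (gclass (mx2 a b ('X * c) d)) (vertex_of (dilation n)) =
      vertex_of (dilation m) ->
  [/\ n = m, degle 0 (polyK a) /\ degle 0 (polyK d),
      degle n (polyK b) & degle (- n - 1) (polyK c)].
Proof.
move=> /Gamma0T_mxP[e e0 ge]; rewrite vertex_of_pgl => /esym /vertex_of_eq[h hK].
have Tn0 (i : int) : T ^ i != 0 by rewrite expfz_neq0 ?T_neq0.
rewrite mx2_map => E.
have detE : \det h = T ^ (n - m) * tofrac (constF e).
  apply: (mulfI (Tn0 m)).
  transitivity (\det (dilation m *m h)); first by rewrite det_mulmx mx2_det; ring.
  rewrite -E det_mulmx !mx2_det (_ : tofrac _ = constK e)// -polyKC -ge.
  by rewrite mulrA -expfzDr ?T_neq0// subrKC rmorphB /= !polyKM; ring.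
move: E; rewrite [X in _ = _ *m X]mx2_eta !mx2M => E.
have {E}[E00 E01 E10 E11] := mx2_inj E.
have {}E00 : h 0 0 = T ^ (n - m) * polyK a.
  apply: (mulfI (Tn0 m)); rewrite mulrA -expfzDr ?T_neq0// subrKC.
  by rewrite -[LHS]addr0 -(mul0r (h 1 0)) -E00; ring.
have {}E01 : polyK b = T ^ m * h 0 1 by rewrite -[RHS]addr0 -(mul0r (h 1 1)) -E01; ring.
have {}E10 : h 1 0 = T ^ (n + 1) * polyK c.
  rewrite expfzDr ?T_neq0// expr1z -[LHS]mul1r -[LHS]add0r -(mul0r (h 0 0)) -E10.
  by rewrite polyKM polyKX; ring.
have {}E11 : h 1 1 = polyK d by rewrite -[LHS]mul1r -[LHS]add0r -(mul0r (h 0 1)) -E11; ring.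
have [//|r [nm hr]] := calK_det hK _ detE.
(* Evaluating the determinant at T = 0 kills the term in b and c, leaving a(0) d(0) = e. *)
have /eqP := congr1 (fun p : {poly k} => p`_0) ge.
rewrite coefB coef0M -mulrA coefXM subr0 coefC /= => ad0.
have [a0 d0] : a != 0 /\ d != 0.
  by split; apply: contraNneq e0 => p0; rewrite -(eqP ad0) p0 coef0 ?mul0r ?mulr0.
have aP : degle (- r) (polyK a).
  by apply/(@degle_shift _ _ (n - m)); rewrite -E00 nm addKr.
have dP : degle r (polyK d) by rewrite -E11.
have r0 : r = 0.
  apply/le_anti/andP; split.
    rewrite -oppr_ge0; case/degle_polyK: aP => [/eqP|]; first by rewrite (negPf a0).
    exact: le_trans.
  case/degle_polyK: dP => [/eqP|]; first by rewrite (negPf d0).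
  exact: le_trans.
have mn : n = m by apply/eqP; rewrite -subr_eq0 nm r0.
rewrite r0 oppr0 in aP; rewrite r0 in dP; rewrite r0 in hr; split=> //.
  by rewrite E01 mn -[m in degle m _]add0r; apply/degle_shift.
by apply/(@degle_shift _ _ (n + 1)); rewrite -E10 (_ : _ + _ = 0)//; ring.
Qed.

Lemma Gamma0T_cusp P c n c' n' : Gamma0T P -> setM P (cl c n) = cl c' n' ->
  c = c' /\ n = n'.
Proof.
move=> /Gamma0TP[g Gg ->]; have [a [b [e [d [gE _]]]]] := Gamma0T_mx_eta Gg.
rewrite !cusp_lift_dilation gE => /Gamma0T_dilation[]; first by rewrite -gE.
by move=> /cusp_exponent_inj.
Qed.

(** * Neighbours in the quotient graph *)

(** Moves a group element past the cusp scaling, so that neighbours need only be computed at the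
    cusp oo. *)
Lemma cusp_scaling_Gamma0T c P : Gamma0T P -> exists2 P', Gamma0T P' &
  forall g, setM (pgl (cusp_scaling k c)) (setM P (vertex_of g)) =
            setM P' (setM (pgl (cusp_scaling k c)) (vertex_of g)).
Proof.
move=> GP; have [->|->] := ord2P c.
  by exists P => // g; have [p _ ->] := Gamma0T_pgl GP; rewrite !vertex_of_pgl !mul1mx.
exists (setM (setM (pgl (atkin_lehner k)) P) (pgl (atkin_lehner k))).
  exact: atkin_lehner_Gamma0T.
move=> g; rewrite -[cusp_scaling k 1]/(atkin_lehner k).
rewrite !setMA; congr setM; congr setM.
by rewrite -setMA atkin_lehner2 vertex_of_pgl mul1mx.
Qed.

Definition cusp_prev c n : set M2 :=
  if n is m.+1 then cl c m else cl (rev_ord c) 0.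

(** For n > 0 a factor T splits off from diag(T^n, T). For n = 0, diag(1, T) gives the central
    vertex of the other cusp, which [rev_ord] names. *)
Lemma cusp_prevE c n :
  vertex_of (cusp_scaling k c *m mx2 (T ^+ n)%R 0 0 T) = cusp_prev c n.
Proof.
case: n => [|n] /=; last first.
  rewrite cusp_liftE /cusp_mx -[RHS](@vertex_ofZ _ T) ?T_neq0// scalemxAr mx2Z.
  by rewrite exprS mulr0 mulr1.
have [->|->] := ord2P c.
  rewrite (_ : rev_ord 0 = 1); last exact: val_inj.
  rewrite cusp_liftE /cusp_mx -(vertex_of_calK (_ *m _) rot_calK).
  rewrite -[cusp_scaling k 0]/(1%:M) -[cusp_scaling k 1]/(mx2 0 (-1) T 0) mul1mx.
  by congr vertex_of; rewrite !mx2M; congr mx2; rewrite ?expr0; ring.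
rewrite (_ : rev_ord 1 = 0); last exact: val_inj.
rewrite cusp_liftE /cusp_mx -[RHS](vertex_of_calK _ rot_calK).
rewrite -[RHS](@vertex_ofZ _ T) ?T_neq0//.
rewrite -[cusp_scaling k 0]/(1%:M) -[cusp_scaling k 1]/(mx2 0 (-1) T 0) mul1mx.
by congr vertex_of; rewrite !mx2M mx2Z; congr mx2; rewrite ?expr0; ring.
Qed.

Lemma cusp_next c n : vertex_of (cusp_mx c n *m nb (Some 0)) = cl c n.+1.
Proof.
rewrite cusp_liftE /cusp_mx -mulmxA /nb mx2M rmorph0 exprSr.
by congr vertex_of; congr mulmx; congr mx2; ring.
Qed.

(** The neighbour [None] is diag(T^n, T) up to a column swap; each [Some x] with x nonzero is
    reached from it by the unipotent with entry T^n / x, a polynomial because n >= 0. *)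
Lemma cusp_nb c n i : i != Some 0 -> exists2 P, Gamma0T P &
  vertex_of (cusp_mx c n *m nb i) = setM P (cusp_prev c n).
Proof.
case: i => [x|] x0; last first.
  exists (pgl 1%:M); first exact: Gamma0T_1.
  rewrite -cusp_prevE vertex_of_pgl mul1mx -(vertex_of_calK (_ *m mx2 _ _ _ _) swap_calK).
  rewrite /cusp_mx -!mulmxA; congr vertex_of; congr mulmx.
  by rewrite /nb !mx2M; congr mx2; ring.
have {}x0 : x != 0 by apply: contraNneq x0 => ->.
have X0 : constK x != 0 by rewrite fmorph_eq0.
pose u : 'M[{poly k}]_2 := mx2 1 (x^-1 *: 'X^n) ('X * 0) 1.
have Gu : Gamma0T (gclass u).
  apply/Gamma0TP; exists u => //; apply/Gamma0T_mxP; exists 1; first exact: oner_neq0.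
  by rewrite polyC1; ring.
have uE : map_mx (@polyK k) u = mx2 1 ((constK x)^-1 * T ^+ n) 0 1.
  rewrite mx2_map -mul_polyC !polyKE rmorphXn /= polyKX fmorphV mulr0.
  by congr mx2.
have [P GP PE] := cusp_scaling_Gamma0T c Gu; exists P => //.
rewrite -cusp_prevE -[X in setM P X]vertex_of_pgl -PE /gclass uE !vertex_of_pgl.
pose h : 'M[fps k]_2 := mx2 0 (- constF x^-1) (constF x) (fpsX k).
have hK : calK (map_mx tofrac h).
  apply: calK_tofrac; rewrite mx2_det mul0r mulNr sub0r opprK.
  by rewrite fcoefM0 /= mulVf// oner_eq0.
rewrite -[RHS](vertex_of_calK _ hK) /cusp_mx -!mulmxA; congr vertex_of; congr mulmx.
have -> : map_mx tofrac h = mx2 0 (- (constK x)^-1) (constK x) T^-1.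
  rewrite mx2_map; congr mx2; last exact: tofracX.
  by rewrite -fmorphV; exact: tofracN.
by rewrite /nb (shear_identity _ (@T_neq0 k) X0).
Qed.

(** * Every vertex is equivalent to a cusp lift *)

Definition in_apartment v := exists P c n, Gamma0T P /\ v = setM P (cl c n).

(** Transport to the lift, whose neighbours are known. The index i becomes some j, since two
    representatives of a vertex may label its neighbours differently. *)
Lemma in_apartment_nb g i : in_apartment (vertex_of g) -> g \in unitmx ->
  in_apartment (vertex_of (g *m nb i)).
Proof.
move=> [P [c [n [GP E]]]] gu; have [p pu PE] := Gamma0T_pgl GP.
have [j ->] : exists j, vertex_of (g *m nb i) = vertex_of (p *m cusp_mx c n *m nb j).
  apply/(adjacentP _ (unitmxM2 pu (cusp_mx_unit c n))).
  rewrite -vertex_of_pgl -cusp_liftE -PE -E.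
  by apply/(adjacentP _ gu); exists i.
rewrite -mulmxA -vertex_of_pgl -PE.
have [->|j0] := eqVneq j (Some 0).
  by exists P, c, n.+1; split; [exact: GP|rewrite cusp_next].
have [Q GQ ->] := cusp_nb c n j0.
rewrite /cusp_prev -setMA; case: n {E} => [|n].
  by exists (setM P Q), (rev_ord c), 0%N; split; first exact: Gamma0T_M.
by exists (setM P Q), c, n; split; first exact: Gamma0T_M.
Qed.

(** N bounds the excess of deg x over e. At N = 0 an integral unipotent on the right absorbs x;
    otherwise raise e by one, a step towards oo, and return through the neighbour [None]. *)
Lemma in_apartment_unipotent (N : nat) e (x : K) : degle (e + N%:Z) x ->
  in_apartment (vertex_of (mx2 (T ^ e)%R x 0 1)).
Proof.
elim: N e => [|N IH] e.
  rewrite addr0 => -[p ->]; have [c [n E]] := dilation_cusp_lift e.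
  exists (pgl 1%:M), c, n; split; first exact: Gamma0T_1.
  rewrite -E vertex_of_pgl mul1mx -[RHS](@vertex_of_calK _ _ (map_mx tofrac (mx2 1 p 0 1))).
    by rewrite mx2_map mx2M tofrac0 tofrac1; congr vertex_of; congr mx2; ring.
  by apply: calK_tofrac; rewrite mx2_det mulr1 mulr0 subr0 /= oner_eq0.
rewrite -addn1 PoszD [N%:Z + _]addrC addrA => /IH{}IH.
have u : mx2 (T ^ (e + 1))%R x 0 1 \in unitmx.
  by apply: mx2_unit; rewrite mulr1 mulr0 subr0 expfz_neq0 ?T_neq0.
have := in_apartment_nb None IH u; congr in_apartment.
rewrite -[RHS](vertex_of_calK _ swap_calK) -[RHS](@vertex_ofZ _ T) ?T_neq0//.
rewrite /nb !mx2M mx2Z expfzDr ?T_neq0// expr1z.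
by congr vertex_of; congr mx2; ring.
Qed.

(** A column swap makes d the lower entry of larger degree; [clear_corner] then applies, and the
    unit part of the diagonal is absorbed on the right. *)
Lemma iwasawa g : g \in unitmx ->
  exists e x, vertex_of g = vertex_of (mx2 (T ^ e)%R x 0 1).
Proof.
suff main (a b c d : K) : a * d - b * c != 0 -> d != 0 -> degle 0 (c / d) ->
    exists e x, vertex_of (mx2 a b c d) = vertex_of (mx2 (T ^ e)%R x 0 1).
  rewrite unitmxE unitfE mx2_detE [g in vertex_of g]mx2_eta.
  move: (g 0 0) (g 0 1) (g 1 0) (g 1 1) => a b c d det0.
  have [d0|d0] := eqVneq d 0.
    rewrite -(vertex_of_calK _ swap_calK) mx2M !(mulr0, mulr1, add0r, addr0).
    have c0 : c != 0 by apply: contraNneq det0 => ->; rewrite d0 !mulr0 subr0.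
    have det0' : b * c - a * d != 0 by rewrite -oppr_eq0 opprB.
    by apply: (main _ _ _ _ det0' c0); rewrite d0 mul0r; exact: degle0.
  have [c0|c0] := eqVneq c 0.
    by apply: (main _ _ _ _ det0 d0); rewrite c0 mul0r; exact: degle0.
  have [e [u [u0 cE]]] := K_factor c0; have [f [w [w0 dE]]] := K_factor d0.
  have [ef|fe] := leP e f.
    apply: (main _ _ _ _ det0 d0).
    rewrite cE dE invfM -tofracV// mulrACA invr_expz -expfzDr ?T_neq0// -tofracM.
    by apply: (@degle_mono _ (e - f)); [rewrite subr_le0|exists (u * w^-1)].
  rewrite -(vertex_of_calK _ swap_calK) mx2M !(mulr0, mulr1, add0r, addr0).
  have det0' : b * c - a * d != 0 by rewrite -oppr_eq0 opprB.
  apply: (main _ _ _ _ det0' c0).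
  rewrite cE dE invfM -tofracV// mulrACA invr_expz -expfzDr ?T_neq0// -tofracM.
  by apply: (@degle_mono _ (f - e)); [rewrite subr_le0 ltW|exists (w * u^-1)].
move=> det0 d0 /degle0P[p pE].
have a0 : (a * d - b * c) / d ^+ 2 != 0.
  by apply: (Kinf_mulf_neq0 det0); rewrite invr_eq0; apply/expf_neq0/d0.
have [e [u [u0 uE]]] := K_factor a0; exists e, (b / d).
rewrite (clear_corner _ _ _ d0) uE pE vertex_ofZ//.
rewrite (_ : mx2 (T ^ e * _) _ _ _ =
             mx2 (T ^ e) (b / d) 0 1 *m map_mx tofrac (mx2 u 0 0 1)); last first.
  by rewrite mx2_map mx2M tofrac0 tofrac1; congr mx2; ring.
rewrite -mulmxA vertex_of_calK//; apply: calKM.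
  by apply: calK_tofrac; rewrite mx2_det mulr1 mulr0 subr0.
rewrite (_ : mx2 1 0 _ 1 = map_mx tofrac (mx2 1 0 p 1)); last first.
  by rewrite mx2_map tofrac0 tofrac1.
by apply: calK_tofrac; rewrite mx2_det mulr1 mul0r subr0 /= oner_eq0.
Qed.

Lemma vertices_apartment v : vertices v -> in_apartment v.
Proof.
move=> /verticesP[g gu ->]; have [e [x ->]] := iwasawa gu.
have [x0|x0] := eqVneq x 0.
  by apply: (@in_apartment_unipotent 0); rewrite x0; exact: degle0.
have [f [u [_ xE]]] := K_factor x0.
apply: (@in_apartment_unipotent `|f - e|%N).
apply: (@degle_mono _ f); last by exists u.
by rewrite -lerBlDl abszE ler_norm.
Qed.

End Quotient.

(** * Local equations of the adjacency operator *)

Section QuotientFunctions.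
Variables (R : realType) (k : finFieldType).
Local Notation C := R[i].
Local Notation M2 := 'M[Kinf k]_2.
Local Notation cl := (cusp_lift k).
Local Notation q := (qC R k).
Implicit Types (f : set M2 -> C) (c : 'I_2) (n : nat).

Lemma adjA_cusp f c n : quotient_function f ->
  adjA f (cl c n) = q * f (@cusp_prev k c n) + f (cl c n.+1).
Proof.
move=> qf; rewrite cusp_liftE (adjA_sum qf (@cusp_mx_unit k c n)).
rewrite (bigD1 (Some 0))//= cusp_next addrC; congr (_ + _).
rewrite (eq_bigr (fun=> f (@cusp_prev k c n))) => [|i i0]; last first.
  have [P GP ->] := cusp_nb c n i0; rewrite qf// /cusp_prev.
  by case: n => *; exact: vertices_cusp.
rewrite sumr_const -mulr_natl; congr (_ * _).
rewrite -[RHS]/((_)%:C) /qR rmorph_nat; congr (_%:R).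
have := cardC1 (Some (0 : k)); rewrite card_option /= => <-.
by apply: eq_card => i; rewrite !inE.
Qed.

End QuotientFunctions.

(** * Stabilizers *)

(** Used twice: for s in Gamma_0(T) it makes lambda constant on orbits, and for the Atkin-Lehner
    matrix it compares the two cusps. *)
Lemma stab_conj (k : fieldType) (s s' : 'M[Kinf k]_2) (v : set 'M[Kinf k]_2) :
    vertices v -> setM (pgl s) (pgl s') = pgl 1%:M -> setM (pgl s') (pgl s) = pgl 1%:M ->
    (forall P, Gamma0T P -> Gamma0T (setM (setM (pgl s) P) (pgl s'))) ->
    (forall P, Gamma0T P -> Gamma0T (setM (setM (pgl s') P) (pgl s))) ->
  ncard (stab (setM (pgl s) v)) = ncard (stab v).
Proof.
move=> vv ss' s's GS GS'.
have v1 : setM (pgl 1%:M) v = v by exact: pgl1_vertex.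
rewrite -[RHS](@ncard_inj _ _ _ (fun P => setM (setM (pgl s) P) (pgl s'))); last first.
  move=> P Q /set_mem[GP _] /set_mem[GQ _] /(congr1 (fun X => setM (setM (pgl s') X) (pgl s))).
  rewrite !setMA s's (Gamma0T_pgl1 GP) (Gamma0T_pgl1 GQ) -!setMA s's.
  by rewrite (pgl1_Gamma0T GP) (pgl1_Gamma0T GQ).
congr ncard; apply/seteqP; split=> [Q [GQ Qv]|_ [P [GP Pv] <-]]; last first.
  by split; [exact: GS|rewrite !setMA -(setMA _ _ v) s's v1 Pv].
exists (setM (setM (pgl s') Q) (pgl s)).
  by split; [exact: GS'|rewrite !setMA Qv -setMA s's v1].
by rewrite !setMA ss' (Gamma0T_pgl1 GQ) -!setMA ss' (pgl1_Gamma0T GQ).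
Qed.

Lemma ncard_stab_Gamma0T (k : fieldType) P (v : set 'M[Kinf k]_2) :
  Gamma0T P -> vertices v -> ncard (stab (setM P v)) = ncard (stab v).
Proof.
move=> GP vv; have [Q GQ [PQ QP]] := Gamma0T_V GP.
have [p _ PE] := Gamma0T_pgl GP; have [q _ QE] := Gamma0T_pgl GQ.
rewrite PE in GP PQ QP *; rewrite QE in GQ PQ QP.
by apply: stab_conj vv PQ QP _ _ => X GX; do 2!apply: Gamma0T_M => //.
Qed.

Section StabilizerOrder.
Variable k : finFieldType.
Local Notation K := (Kinf k).
Local Notation T := (Tinf k).
Local Notation M2 := 'M[K]_2.
Local Notation tofrac := (@FracField.tofrac (fps k)).
Local Notation cl := (cusp_lift k).
Local Notation borel n := ({x : k | x != 0} * 'rV[k]_n.+1)%type.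

(** The lower-right entry is normalised to 1, giving one matrix per class in PGL_2; a row of length
    n+1 encodes a polynomial of degree at most n. *)
Definition borel_mx n (t : borel n) : 'M[{poly k}]_2 :=
  mx2 (val t.1)%:P (rVpoly t.2) ('X * 0) 1.

Lemma borel_mx_inj n : injective (fun t : borel n => gclass (borel_mx t)).
Proof.
move=> [[x x0] r] [[y y0] t] E.
have : gclass (borel_mx (exist _ y y0, t)) (map_mx (@polyK k) (borel_mx (exist _ x x0, r))).
  by rewrite -E; exact: pgl_id.
move=> [z _]; rewrite !mx2_map mx2Z => {}E; have [] := mx2_inj E.
rewrite !polyK1 mulr1 => + + _ z1; rewrite z1 !mul1r /= => xy rt; congr pair.
  by apply/val_inj/polyC_inj/polyK_inj.
by apply: (can_inj rVpolyK); apply/polyK_inj.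
Qed.

Lemma degle_size (n : nat) (p : {poly k}) : degle n (polyK p) <-> (size p <= n.+1)%N.
Proof.
split=> [/degle_polyK[->|]|pn]; first by rewrite size_poly0.
  by rewrite lez_nat; case: (size p).
apply/degle_polyK; right; rewrite lez_nat.
by case: (size p) pn.
Qed.

(** By [Gamma0T_dilation] with equal exponents n >= 0, c has negative degree and vanishes, a and d
    are constants, and deg b <= n; dividing by d reaches the normal form. *)
Lemma stab_borel n :
  stab (cl 0 n) = [set gclass (borel_mx t) | t in [set t : borel n | predT t]].
Proof.
rewrite cusp_lift_dilation -[cusp_exponent 0 n]/(Posz n).
apply/seteqP; split=> [P [/Gamma0TP[g Gg ->]]|_ [[[x x0] r] _ <-]].
  have [a [b [c [d [gE [e e0 ge]]]]]] := Gamma0T_mx_eta Gg.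
  rewrite gE in Gg * => /(Gamma0T_dilation Gg)[_ [aP dP] bP cP].
  have c0 : c = 0.
    by case/degle_polyK: cP => //; move: (size c).-1 => m; lia.
  have [x aE] : exists x, a = x%:P by exists a`_0; apply/size1_polyC/degle_size.
  have [y dE] : exists y, d = y%:P by exists d`_0; apply/size1_polyC/degle_size.
  have xy : x * y = e.
    by apply: polyC_inj; rewrite -ge aE dE c0 mulr0 subr0 polyCM.
  have /andP[x0 y0] : (x != 0) && (y != 0) by rewrite -negb_or -mulf_eq0 xy.
  have xy0 : x / y != 0 by rewrite mulf_neq0// invr_eq0.
  exists (exist _ (x / y) xy0, poly_rV (y^-1 *: b)) => //.
  rewrite /borel_mx /= poly_rV_K; last by rewrite size_scale ?invr_eq0//; apply/degle_size.
  rewrite aE dE c0 /gclass -[LHS](@pglZ _ (constK y)) ?fmorph_eq0// !mx2_map mx2Z.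
  rewrite -mul_polyC !polyKE !mulr0 mulr1 mulrA -!rmorphM /=.
  by rewrite mulrCA divff// mulr1 rmorph1 mul1r.
have GB : Gamma0T_mx (borel_mx (exist _ x x0, r)).
  by apply/Gamma0T_mxP; exists x => //; rewrite mulr1 mulr0 subr0.
split; first by apply/Gamma0TP; exists (borel_mx (exist _ x x0, r)).
have [p pE] : degle n (polyK (rVpoly r)).
  by apply/degle_size; exact: size_poly.
rewrite vertex_of_pgl mx2_map /= !polyKE pE mulr0 /dilation.
rewrite -[RHS](@vertex_of_calK _ _ (map_mx tofrac (mx2 (constF x) p 0 1))).
  rewrite mx2_map !mx2M tofrac0 tofrac1 (_ : tofrac (constF x) = constK x)//.
  by congr vertex_of; congr mx2; ring.
by apply: calK_tofrac; rewrite mx2_det mulr1 mulr0 subr0.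
Qed.

Lemma card_borel n : #|[pred t : borel n | predT t]| = (#|k|.-1 * #|k| ^ n.+1)%N.
Proof.
rewrite (_ : #|_| = #|{: borel n}|); last exact: eq_card.
by rewrite card_prod card_mx mul1n card_sig -(cardC1 (0 : k)).
Qed.

Lemma ncard_stab_cusp c n : ncard (stab (cl c n)) = (#|k|.-1 * #|k| ^ n.+1)%N.
Proof.
transitivity (ncard (stab (cl 0 n))); last first.
  by rewrite stab_borel ncard_fin ?card_borel//; exact: borel_mx_inj.
have [->//|->] := ord2P c.
rewrite (_ : cl 1 n = setM (pgl (atkin_lehner k)) (cl 0 n)); last first.
  by rewrite vertex_of_pgl mul1mx.
have AL := @atkin_lehner_Gamma0T k.
exact: (stab_conj (vertices_cusp k 0 n) (@atkin_lehner2 k) (@atkin_lehner2 k) AL AL).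
Qed.

End StabilizerOrder.

(** * Functions on the quotient graph *)

Section Scattering.
Variables (R : realType) (k : finFieldType).
Local Notation C := R[i].
Local Notation M2 := 'M[Kinf k]_2.
Local Notation cl := (cusp_lift k).
Local Notation qR := (qR R k).
Local Notation q := (qC R k).
Local Notation a := (aC R k).
Local Notation lam := (lam R).
Implicit Types (f : set M2 -> C) (v : set M2) (c : 'I_2) (n : nat) (x y E : C).

Lemma k_gt1 : (1 < #|k|)%N.
Proof. exact: card_finNzRing_gt1. Qed.

Lemma qR_gt1 : 1 < qR.
Proof. by rewrite ltr1n k_gt1. Qed.

Lemma qR_gt0 : 0 < qR.
Proof. exact: lt_trans ltr01 qR_gt1. Qed.

Lemma q_neq0 : q != 0.
Proof. by rewrite fmorph_eq0 gt_eqF// qR_gt0. Qed.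

Lemma a_neq0 : a != 0.
Proof. by rewrite fmorph_eq0 gt_eqF// sqrtr_gt0 qR_gt0. Qed.

Lemma a_sqr : a ^+ 2 = q.
Proof. by rewrite -rmorphXn /= sqr_sqrtr// ltW// qR_gt0. Qed.

Lemma lam_cusp c n : lam (cl c n) = ((qR - 1) * qR ^+ n.+1)^-1.
Proof.
rewrite /Defs.lam ncard_stab_cusp natrM natrX; congr (_ * _)^-1.
by rewrite -subn1 natrB ?(ltnW k_gt1).
Qed.

Lemma lam_Gamma0T P v : Gamma0T P -> vertices v -> lam (setM P v) = lam v.
Proof. by move=> GP vv; rewrite /Defs.lam ncard_stab_Gamma0T. Qed.

Definition slam v : C := (Num.sqrt (lam v))%:C.

(** The leading constant is the same for both cusps, so U only rescales the incoming and outgoing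
    data by a common factor. *)
Lemma slam_cusp c n : slam (cl c n) = slam (cl 0 0) / a ^+ n.
Proof.
rewrite /slam -rmorphXn -fmorphV -rmorphM; congr (_%:C).
rewrite !lam_cusp expr1 exprS mulrA invfM sqrtrM ?invr_ge0 ?mulr_ge0 ?subr_ge0 ?ltW ?qR_gt0 ?qR_gt1//.
rewrite [X in _ * X = _]sqrtrV ?exprn_ge0 ?(ltW qR_gt0)//; congr (_ * _^-1).
elim: n => [|n IH]; first by rewrite !expr0 sqrtr1.
by rewrite !exprS sqrtrM ?(ltW qR_gt0)// IH.
Qed.

Lemma slam_neq0 v : vertices v -> slam v != 0.
Proof.
move=> /vertices_apartment[P [c [n [GP ->]]]].
rewrite /slam lam_Gamma0T//; last exact: vertices_cusp.
rewrite fmorph_eq0 sqrtr_eq0 -ltNge lam_cusp invr_gt0.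
by rewrite mulr_gt0 ?exprn_gt0 ?qR_gt0// subr_gt0 qR_gt1.
Qed.

Lemma quotient_opU f : quotient_function f -> quotient_function (opU f).
Proof. by move=> qf P v GP vv; rewrite /opU lam_Gamma0T// qf. Qed.

Lemma quotient_opUinv f : quotient_function f -> quotient_function (opUinv f).
Proof. by move=> qf P v GP vv; rewrite /opUinv lam_Gamma0T// qf. Qed.

Lemma quotient_adjA f : quotient_function f -> quotient_function (adjA f).
Proof. by move=> qf P v GP vv; exact: adjA_Gamma0T. Qed.

Lemma quotient_eq f1 f2 : quotient_function f1 -> quotient_function f2 ->
  (forall c n, f1 (cl c n) = f2 (cl c n)) -> forall v, vertices v -> f1 v = f2 v.
Proof.
move=> qf1 qf2 E v /vertices_apartment[P [c [n [GP ->]]]].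
have vc := vertices_cusp k c n.
by rewrite (qf1 _ _ GP vc) (qf2 _ _ GP vc).
Qed.

(** Extends values on the lifts by invariance. [Gamma0T_cusp] makes the chosen pair unique, and the
    default is never met on vertices. *)
Definition from_cusps (phi : 'I_2 -> nat -> C) v : C :=
  let cn := xget (0, 0%N) [set cn | exists2 P, Gamma0T P & v = setM P (cl cn.1 cn.2)]
  in phi cn.1 cn.2.

Lemma from_cuspsE phi P c n : Gamma0T P -> from_cusps phi (setM P (cl c n)) = phi c n.
Proof.
move=> GP; rewrite /from_cusps.
case: xgetP => [[c' n'] _ [Q GQ E]|/(_ (c, n))[]]; last by exists P.
have [P' GP' [_ P'P]] := Gamma0T_V GP.
have [||<- <-//] := @Gamma0T_cusp _ (setM P' Q) c' n' c n; first exact: Gamma0T_M.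
by rewrite setMA -E -setMA P'P pgl1_vertex//; exact: vertices_cusp.
Qed.

Lemma from_cusps_cusp phi c n : from_cusps phi (cl c n) = phi c n.
Proof.
rewrite -(pgl1_vertex (vertices_cusp k c n)) from_cuspsE//; exact: Gamma0T_1.
Qed.

Lemma quotient_from_cusps phi : quotient_function (from_cusps phi).
Proof.
move=> P v GP /vertices_apartment[Q [c [n [GQ ->]]]].
by rewrite -setMA !from_cuspsE//; exact: Gamma0T_M.
Qed.

Lemma quotient_delta v : vertices v -> quotient_function (delta_at R v).
Proof.
move=> vv P w GP vw; rewrite /delta_at; congr (_%:R); apply: congr1.
have [Q GQ [PQ QP]] := Gamma0T_V GP.
apply/idP/idP; rewrite !inE => -[X GX E].
  exists (setM Q X); first exact: Gamma0T_M.
  by rewrite setMA E -setMA QP pgl1_vertex.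
by exists (setM P X); [exact: Gamma0T_M|rewrite setMA E].
Qed.

Lemma delta_cusp c n c' n' :
  delta_at R (cl c n) (cl c' n') = ((c == c') && (n == n'))%:R.
Proof.
rewrite /delta_at; congr (_%:R); apply: congr1; apply/idP/idP.
  by rewrite inE => -[P GP /(Gamma0T_cusp GP)[-> ->]]; rewrite !eqxx.
move=> /andP[/eqP -> /eqP ->]; rewrite inE; exists (pgl 1%:M).
  exact: Gamma0T_1.
by apply: pgl1_vertex; exact: vertices_cusp.
Qed.

End Scattering.

(** * Scattering *)

Section ScatteringAlgebra.
Variable F : fieldType.
Implicit Types a m : F.

Definition scattering_mx a m : 'M[F]_2 :=
  (m ^+ 2 - a ^+ 2)^-1 *:
    mx2 (a ^+ 2 - 1) (a * (m ^+ 2 - 1) / m) (a * (m ^+ 2 - 1) / m) (a ^+ 2 - 1).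

(** Adding a m times the first equation to a^2 times the second eliminates v' and leaves u' with
    coefficient a^2 (m^2 - a^2). *)
Lemma core_equation_solve a m (u v u' v' : F) :
    a != 0 -> m != 0 -> m ^+ 2 - a ^+ 2 != 0 ->
    a ^+ 2 * (v + v') = a / m * u + a * m * u' ->
    a ^+ 2 * (u + u') = a / m * v + a * m * v' ->
  u' = (m ^+ 2 - a ^+ 2)^-1 * ((a ^+ 2 - 1) * u + a * (m ^+ 2 - 1) / m * v).
Proof.
move=> a0 m0 d0 E1 E2.
apply: (mulfI d0); rewrite mulVKf//; apply: (mulfI (expf_neq0 2 a0)).
apply/eqP; rewrite -subr_eq0 -[X in _ == X](_ :
  a * m * (a / m * u + a * m * u' - a ^+ 2 * (v + v')) +
  a ^+ 2 * (a / m * v + a * m * v' - a ^+ 2 * (u + u')) = 0); last first.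
  by rewrite E1 E2 !subrr !mulr0 addr0.
by apply/eqP; field.
Qed.

(** The hypotheses are the eigenvalue equations at the two central vertices. They are exchanged by
    [rev_ord], so one elimination serves both rows. *)
Lemma core_equation_scattering a m (b b' : 'cV[F]_2) :
    a != 0 -> m != 0 -> m ^+ 2 - a ^+ 2 != 0 ->
  (forall c, a ^+ 2 * (b (rev_ord c) 0 + b' (rev_ord c) 0) =
             a / m * b c 0 + a * m * b' c 0) <-> b' = scattering_mx a m *m b.
Proof.
move=> a0 m0 d0.
have r0 : rev_ord (0 : 'I_2) = 1 by exact: val_inj.
have r1 : rev_ord (1 : 'I_2) = 0 by exact: val_inj.
have SE c : (scattering_mx a m *m b) c 0 = (m ^+ 2 - a ^+ 2)^-1 *
    ((a ^+ 2 - 1) * b c 0 + a * (m ^+ 2 - 1) / m * b (rev_ord c) 0).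
  rewrite mxE !big_ord_recl big_ord0 addr0 /scattering_mx.
  rewrite (_ : lift ord0 ord0 = 1); last exact: val_inj.
  rewrite mx2Z.
  have [->|->] := ord2P c; rewrite ?r0 ?r1 !mx2E; ring.
split=> [E|-> c]; last first.
  rewrite !SE rev_ordK; field; by rewrite m0 d0.
apply/matrixP => c j; rewrite ord1 SE.
apply: (@core_equation_solve a m _ _ _ (b' (rev_ord c) 0)) => //.
by rewrite -E rev_ordK.
Qed.

Lemma det_scattering_mx a m : m != 0 -> m ^+ 2 - a ^+ 2 != 0 ->
  \det (scattering_mx a m) =
  (1 - a ^+ 2 * m ^+ 2) / (m ^+ 2 * (m ^+ 2 - a ^+ 2)).
Proof.
move=> m0 d0; rewrite detZ mx2_det; field; by rewrite m0 d0.
Qed.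

Lemma invmx2 (M : 'M[F]_2) : \det M != 0 -> invmx M = (\det M)^-1 *: adj2 M.
Proof.
move=> d0; have Mu : M \in unitmx by rewrite unitmxE unitfE.
apply: (can_inj (mulKmx Mu)); rewrite mulmxV// -scalemxAr mul_mx_adj2.
by rewrite scale_scalar_mx mulVf.
Qed.

Lemma scattering_mxE a m : a != 0 -> m != 0 -> m ^+ 2 - a ^+ 2 != 0 ->
  - 1%:M + ((m^-1 - m) / a) *:
    (a%:M *m invmx (mx2 (- a * m) (a ^+ 2) (a ^+ 2) (- a * m)) *m a%:M) =
  scattering_mx a m.
Proof.
move=> a0 m0 d0.
have detE : \det (mx2 (- a * m) (a ^+ 2) (a ^+ 2) (- a * m)) =
    a ^+ 2 * (m ^+ 2 - a ^+ 2) by rewrite mx2_det; ring.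
have det0 : a ^+ 2 * (m ^+ 2 - a ^+ 2) != 0 by rewrite mulf_neq0 ?expf_neq0.
rewrite invmx2 detE// /adj2 !mx2E !mx2_scalar mx2Z !mx2M !mx2Z mx2N mx2D.
rewrite /scattering_mx mx2Z; congr mx2; field; by rewrite a0 m0 d0.
Qed.

End ScatteringAlgebra.

(** * Generalized eigenfunctions and their scattering matrices *)

Section ScatteringMatrices.
Variables (R : realType) (k : finFieldType).
Local Notation C := R[i].
Local Notation M2 := 'M[Kinf k]_2.
Local Notation cl := (cusp_lift k).
Local Notation q := (qC R k).
Local Notation a := (aC R k).
Implicit Types (f : set M2 -> C) (v : set M2) (c : 'I_2) (n : nat) (x y : C).
Implicit Types b : 'cV[C]_2.

Lemma adjA_cusp0 f c : quotient_function f ->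
  adjA f (cl c 0) = q * f (cl (rev_ord c) 0) + f (cl c 1).
Proof. by move=> qf; exact: adjA_cusp c 0 qf. Qed.

Lemma adjA_cuspS f c n : quotient_function f ->
  adjA f (cl c n.+1) = q * f (cl c n) + f (cl c n.+2).
Proof. by move=> qf; exact: adjA_cusp c n.+1 qf. Qed.

Lemma adjA_eigenP x y b b' f : x * y = q ->
  generalized_eigenfunction (@adjA R k) (x + y) x y b b' f <->
  [/\ quotient_function f,
      forall c n, f (cl c n) = x ^+ n * b c 0 + y ^+ n * b' c 0 &
      forall c, q * (b (rev_ord c) 0 + b' (rev_ord c) 0) = y * b c 0 + x * b' c 0].
Proof.
move=> xy; split=> [[qf Ef fE]|[qf fE core]]; last first.
  split=> //; apply: quotient_eq; first exact: quotient_adjA.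
    by move=> P v GP vv; rewrite qf.
  move=> c [|n].
    rewrite (adjA_cusp0 c qf) (fE (rev_ord c) 0%N) (fE c 1%N) (fE c 0%N).
    by rewrite !expr0 !mul1r core; ring.
  rewrite (adjA_cuspS c n qf) (fE c n) (fE c n.+1) (fE c n.+2) -xy !exprS.
  by ring.
have fE0 c : f (cl c 0) = b c 0 + b' c 0.
  have := Ef _ (vertices_cusp k c 1); rewrite (adjA_cuspS c 0 qf).
  rewrite (fE c 1%N isT) (fE c 2%N isT) => E.
  apply: (mulfI (@q_neq0 R k)); apply: (addIr (x ^+ 2 * b c 0 + y ^+ 2 * b' c 0)).
  by rewrite E -xy; ring.
split=> // [c [|n]|c]; [by rewrite fE0 !expr0 !mul1r|by rewrite fE|].
have := Ef _ (vertices_cusp k c 0); rewrite (adjA_cusp0 c qf) !fE0 (fE c 1%N isT) => E.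
apply: (addIr (x ^+ 1 * b c 0 + y ^+ 1 * b' c 0)).
by rewrite E; ring.
Qed.

Lemma scattering_adjA mu : mu != 0 -> mu ^+ 2 - a ^+ 2 != 0 ->
  scattering_matrix (@adjA R k) (a * mu + a / mu) (a * mu) (a / mu)
    (scattering_mx a mu).
Proof.
move=> mu0 d0 b; have a0 := @a_neq0 R k.
have xy : a * mu * (a / mu) = q by rewrite -a_sqr; field.
have solP b' := core_equation_scattering b b' a0 mu0 d0.
rewrite a_sqr in solP.
have uniq b' f : generalized_eigenfunction (@adjA R k) (a * mu + a / mu) (a * mu) (a / mu) b b' f ->
    b' = scattering_mx a mu *m b.
  by move=> /(adjA_eigenP _ _ _ xy)[_ _ /solP].
split=> // [|b1 b2 f1 f2 g1 g2].
  exists (@from_cusps R k (fun c n => (a * mu) ^+ n * b c 0 +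
            (a / mu) ^+ n * (scattering_mx a mu *m b) c 0)).
  apply/(adjA_eigenP _ _ _ xy); split.
  - exact: quotient_from_cusps.
  - by move=> c n; rewrite from_cusps_cusp.
  - exact/solP.
have b1E := uniq _ _ g1; have b2E := uniq _ _ g2.
move/(adjA_eigenP _ _ _ xy): g1 => [q1 E1 _].
move/(adjA_eigenP _ _ _ xy): g2 => [q2 E2 _].
by apply: quotient_eq => // c n; rewrite E1 E2 b1E b2E.
Qed.

(** Needed because [opUinv (opU f)] is only known to agree with f at vertices, where lambda is
    nonzero. *)
Lemma adjA_ext f1 f2 : quotient_function f1 -> quotient_function f2 ->
    (forall v, vertices v -> f1 v = f2 v) ->
  forall v, vertices v -> adjA f1 v = adjA f2 v.
Proof.
move=> q1 q2 E v /verticesP[g gu ->]; rewrite !adjA_sum//.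
by apply: eq_bigr => i _; apply: E; exact: vertices_of (unitmxM2 gu (nb_unit i)).
Qed.

(** * Conjugation by the square root of lambda *)

Local Notation L := (@slam R k (cl 0 0)).

Lemma L_neq0 : L != 0.
Proof. exact: slam_neq0 (vertices_cusp k 0 0). Qed.

Lemma opU_cusp f c n : opU f (cl c n) = L / a ^+ n * f (cl c n).
Proof. by rewrite /opU -/(slam R _) slam_cusp. Qed.

Lemma opUinv_cusp f c n : opUinv f (cl c n) = L^-1 * a ^+ n * f (cl c n).
Proof. by rewrite /opUinv -/(slam R _) slam_cusp invfM invrK. Qed.

(** The factor L / a^n turns (a mu)^n and (a / mu)^n into L mu^n and L mu^-n. *)
Lemma eigen_adjA_jacobiJ mu b b' f : mu != 0 ->
  generalized_eigenfunction (@adjA R k) (a * mu + a / mu) (a * mu) (a / mu) b b' f ->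
  generalized_eigenfunction (@jacobiJ R k) (a * (mu + mu^-1)) mu mu^-1
    (L *: b) (L *: b') (opU f).
Proof.
move=> mu0 [qf Ef fE]; have a0 := @a_neq0 R k; split.
- exact: quotient_opU.
- move=> v vv; rewrite /jacobiJ /opU -/(slam R v).
  rewrite (@adjA_ext _ f) ?Ef//; first by ring.
    exact/quotient_opUinv/quotient_opU.
  move=> w vw; rewrite /opUinv /opU -/(slam R w) mulKf//; exact: slam_neq0.
- move=> c n n0; rewrite opU_cusp fE// !mxE !exprMn !exprVn.
  by field; rewrite !expf_neq0.
Qed.

Lemma eigen_jacobiJ_adjA mu b b' f : mu != 0 ->
  generalized_eigenfunction (@jacobiJ R k) (a * (mu + mu^-1)) mu mu^-1 b b' f ->
  generalized_eigenfunction (@adjA R k) (a * mu + a / mu) (a * mu) (a / mu)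
    (L^-1 *: b) (L^-1 *: b') (opUinv f).
Proof.
move=> mu0 [qf Ef fE]; have a0 := @a_neq0 R k; split.
- exact: quotient_opUinv.
- move=> v vv; have s0 := slam_neq0 R vv.
  apply: (mulfI s0); rewrite -[LHS]/(jacobiJ f v) Ef// /opUinv -/(slam R v).
  by rewrite mulrCA mulVKf//; ring.
- move=> c n n0; rewrite opUinv_cusp fE// !mxE !exprMn !exprVn.
  by ring.
Qed.

Lemma scattering_jacobiJ mu : mu != 0 -> mu ^+ 2 - a ^+ 2 != 0 ->
  scattering_matrix (@jacobiJ R k) (a * (mu + mu^-1)) mu mu^-1 (scattering_mx a mu).
Proof.
move=> mu0 d0 b; have [[f Ef] uniqb uniqf] := scattering_adjA mu0 d0 (L^-1 *: b).
have L0 := L_neq0; split.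
- exists (opU f); have := eigen_adjA_jacobiJ mu0 Ef.
  by rewrite -scalemxAr !scalerA divff// !scale1r.
- move=> b' g /(eigen_jacobiJ_adjA mu0) /uniqb; rewrite -scalemxAr.
  by move=> /(congr1 (fun M => L *: M)); rewrite !scalerA divff// !scale1r.
- move=> b1 b2 f1 f2 /(eigen_jacobiJ_adjA mu0) E1 /(eigen_jacobiJ_adjA mu0) E2 v vv.
  have := uniqf _ _ _ _ E1 E2 v vv; rewrite /opUinv -/(slam R v).
  by apply: mulfI; rewrite invr_eq0 slam_neq0.
Qed.

(** The columns are the outgoing data of the basis vectors, which are determined by the incoming
    ones. *)
Lemma scattering_matrix_unique (Op : (set M2 -> C) -> set M2 -> C) E x y S S' :
  scattering_matrix Op E x y S -> scattering_matrix Op E x y S' -> S = S'.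
Proof.
move=> hS hS'; apply/matrixP => i j.
have [[f Ef] _ _] := hS (delta_mx j 0); have [_ uniq _] := hS' (delta_mx j 0).
have := uniq _ _ Ef; rewrite -!colE => /matrixP/(_ i 0).
by rewrite !mxE.
Qed.

(** * Explicit blocks of J, the matrices F and S, and the cusp widths *)

Lemma HCE : HC R k = mx2 0 q q 0.
Proof.
have L0 := L_neq0.
have E i j : HC R k i j = q * (rev_ord i == j)%:R.
  have qd := quotient_delta R (vertices_cusp k j 0).
  rewrite mxE /jacobiJ opU_cusp (adjA_cusp0 i (quotient_opUinv qd)).
  rewrite !opUinv_cusp !delta_cusp andbF mulr0 addr0 eqxx andbT eq_sym.
  by rewrite expr0; field.
by apply: mx2P; rewrite !mx2E !E /= mulr0 mulr1.
Qed.

Lemma VCE : VC R k = a%:M.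
Proof.
have L0 := L_neq0; have a0 := @a_neq0 R k.
apply/matrixP => i c.
have qd := quotient_delta R (vertices_cusp k c 1).
rewrite mxE /jacobiJ opU_cusp (adjA_cusp0 i (quotient_opUinv qd)).
rewrite !opUinv_cusp !delta_cusp andbF !mulr0 add0r eqxx andbT eq_sym mxE.
case: (i == c); rewrite ?mulr0 ?mulr0n ?mulr1n ?mulr1 ?expr0 ?expr1; last by ring.
by field.
Qed.

Lemma VC_adjoint : map_mx Num.conj (VC R k)^T = a%:M.
Proof.
rewrite VCE tr_scalar_mx map_scalar_mx /=; congr (_%:M).
by apply: conj_Creal; apply: ger0_real; rewrite lecR sqrtr_ge0.
Qed.

Lemma FmatE mu : mu != 0 -> Fmat k mu = mx2 (- a * mu) (a ^+ 2) (a ^+ 2) (- a * mu).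
Proof.
move=> mu0; have a0 := @a_neq0 R k.
rewrite /Fmat VC_adjoint VCE HCE -a_sqr !mx2_scalar mx2M mx2Z mx2N !mx2D.
by congr mx2; field; rewrite a0 mu0.
Qed.

Lemma SmatE mu : mu != 0 -> mu ^+ 2 - a ^+ 2 != 0 -> Smat k mu = scattering_mx a mu.
Proof.
move=> mu0 d0; rewrite /Smat VC_adjoint VCE FmatE// scattering_mxE//; exact: a_neq0.
Qed.

Lemma cusp_widthE : cusp_width_matrix k ((q * (q ^+ 2 - 1))^-1)%:M.
Proof.
split; first exact: scalar_mx_is_diag.
move=> c n _; rewrite lam_cusp mxE eqxx mulr1n.
have q1 : q - 1 != 0.
  rewrite (_ : q - 1 = (qR R k - 1)%:C); last by rewrite rmorphB rmorph1.
  by rewrite fmorph_eq0 gt_eqF// subr_gt0 qR_gt1.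
have q2 : q + 1 != 0.
  rewrite (_ : q + 1 = (qR R k + 1)%:C); last by rewrite rmorphD rmorph1.
  by rewrite fmorph_eq0 gt_eqF// addr_gt0 ?qR_gt0.
have q0 := @q_neq0 R k.
rewrite (_ : (_^-1)%:C = ((q - 1) * q ^+ n.+1)^-1); last first.
  by rewrite fmorphV rmorphM rmorphXn rmorphB rmorph1.
rewrite exprS (_ : q ^+ 2 - 1 = (q - 1) * (q + 1)); last by ring.
move: (q - 1) (q + 1) q1 q2 => p1 p2 p10 p20.
have := expf_neq0 n q0; move: (q ^+ n) => qn qn0; move: q q0 => x x0.
by field; rewrite p10 p20 x0 qn0.
Qed.

(** * Complex powers of [q] *)

Lemma qpowD (s t : C) : qpow k (s + t) = qpow k s * qpow k t.
Proof.
case: s t => [s s'] [t t']; rewrite /qpow /= !mulrDl expRD cosD sinD.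
apply/eqP; rewrite eq_complex /=; apply/andP; split; apply/eqP; ring.
Qed.

Lemma qpow0 : qpow k (0 : C) = 1.
Proof.
rewrite -[0 : C]/(0 +i* 0) /qpow /= !mul0r expR0 cos0 sin0.
by apply/eqP; rewrite eq_complex /=; apply/andP; split; apply/eqP; ring.
Qed.

Lemma qpow_neq0 (s : C) : qpow k s != 0.
Proof.
have : qpow k s * qpow k (- s) != 0 by rewrite -qpowD subrr qpow0 oner_neq0.
by apply: contraNneq => ->; rewrite mul0r.
Qed.

Lemma qpowN (s : C) : qpow k (- s) = (qpow k s)^-1.
Proof.
by apply: (mulfI (qpow_neq0 s)); rewrite -qpowD subrr qpow0 mulfV// qpow_neq0.
Qed.

Lemma qpow_half : qpow k (2^-1 : C) = a.
Proof.
rewrite (_ : 2^-1 = (2^-1 : R)%:C); last by rewrite fmorphV rmorph_nat.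
rewrite /qpow /= mul0r cos0 sin0 /aC.
(* Both sides are nonnegative with square q. *)
rewrite (_ : expR _ = Num.sqrt (qR R k)).
  by apply/eqP; rewrite eq_complex /=; apply/andP; split; apply/eqP; ring.
rewrite -[LHS]ger0_norm ?expR_ge0// -sqrtr_sqr expr2 -expRD -mulrDl.
rewrite (_ : 2^-1 + 2^-1 = 1); last by field.
by rewrite mul1r lnK// posrE qR_gt0.
Qed.

End ScatteringMatrices.

Theorem proposition5p2 (R : realType) (k : finFieldType) :
  let q : R[i] := qC R k in
  let a : R[i] := aC R k in
  [/\ forall mu : R[i], mu != 0 ->
        Fmat k mu = mx2 (- a * mu) q q (- a * mu) /\
        \det (Fmat k mu) = q * (mu ^+ 2 - q),
      forall mu : R[i], mu != 0 -> mu ^+ 2 != q ->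
        Smat k mu = (mu ^+ 2 - q)^-1 *:
          mx2 (q - 1) (a * (mu ^+ 2 - 1) / mu)
              (a * (mu ^+ 2 - 1) / mu) (q - 1) /\
        \det (Smat k mu) = (1 - q * mu ^+ 2) / (mu ^+ 2 * (mu ^+ 2 - q)),
      [/\ HC R k = mx2 0 q q 0, VC R k = a%:M &
        cusp_width_matrix k ((q * (q ^+ 2 - 1))^-1)%:M],
      forall mu : R[i], mu != 0 -> mu ^+ 2 != q ->
        scattering_matrix (@jacobiJ R k) (a * (mu + mu^-1)) mu mu^-1
          (Smat k mu) &
      forall s : R[i], qpow k (s - 2^-1) ^+ 2 != q ->
        constant_term_matrix k s (Saut k s) /\
        Saut k s = Smat k (qpow k (s - 2^-1))].
Proof.
move=> q a; have qE : q = a ^+ 2 by rewrite a_sqr.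
have d0 (mu : R[i]) : mu ^+ 2 != q -> mu ^+ 2 - a ^+ 2 != 0.
  by rewrite subr_eq0 -qE.
split.
- move=> mu mu0; rewrite (FmatE k mu0) qE; split; first by [].
  by rewrite mx2_det; ring.
- move=> mu mu0 /d0 mud; rewrite (SmatE mu0 mud) qE; split; first by [].
  exact: det_scattering_mx mu0 mud.
- split; [exact: HCE|exact: VCE|exact: cusp_widthE].
- move=> mu mu0 /d0 mud; rewrite (SmatE mu0 mud); exact: scattering_jacobiJ mu0 mud.
- move=> s; set mu := qpow k (s - 2^-1) => /d0 mud.
  have mu0 : mu != 0 by exact: qpow_neq0.
  have sE : qpow k s = a * mu by rewrite /a -qpow_half -qpowD addrC subrK.
  have s1E : qpow k (1 - s) = a / mu.
    rewrite /a -qpow_half -qpowN -qpowD; congr qpow.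
    by field.
  (* Existence of a constant-term matrix makes the choice in [Saut] meaningful; uniqueness then
     identifies the chosen matrix. *)
  have S0 : constant_term_matrix k s (Smat k mu).
    by rewrite /constant_term_matrix sE s1E (SmatE mu0 mud); exact: scattering_adjA mu0 mud.
  have S1 : constant_term_matrix k s (Saut k s) by exact: xgetI S0.
  by split=> //; exact: scattering_matrix_unique S1 S0.
Qed.
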